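(* Let $(\mu_1,\mu_2)=\mathcal{N}(\sigma_1,\sigma_2)$ be a Nikishin system of two measures on the unit circle, with associated arcs $\Gamma_1,\Gamma_2$, and let the branch of $z^{1/2}$ be chosen with its cut direction $e^{it_0}\notin\Gamma_1\cup\Gamma_2$. Suppose that $F_{\sigma_2}(z)$ is nonzero on $\Gamma_1$. Then: (i) any $\bm{n}=(n_1,n_2)\in\mathbb{N}^2$ with $n_1$ and $n_2$ both odd is $\phi$-normal with respect to $(\mu_1,\mu_2)$; (ii) any $\bm{n}=(n_1,n_2)\in\mathbb{N}^2$ with $n_1$ and $n_2$ both even is $\phi$-normal with respect to $(\mu_1,\mu_2)$.
   Context: $\mathbb{N}=\{0,1,2,\ldots\}$; $|\bm{n}|=n_1+n_2$; $\partial\mathbb{D}$ is the complex unit circle. An arc is a set $\Gamma=\{e^{i\theta}:\alpha\le\theta\le\beta\}$ with $0<\beta-\alpha\le2\pi$; $\mathring{\Gamma}$ is its interior in $\partial\mathbb{D}$. $\mathcal{M}(\Gamma)$ is the set of finite Borel measures on $\partial\mathbb{D}$ of constant sign (either positive or negative) with infinite support contained in $\Gamma$. Square root. For a fixed $t_0\in\mathbb{R}$, $z^{1/2}=|z|^{1/2}\exp\big(i\arg_{[t_0,t_0+2\pi)}(z)/2\big)$, and half-integer powers are $z^{k/2}=(z^{1/2})^k$, $k\in\mathbb{Z}$. Carathéodory function. $F_\mu(z)=\int_{\partial\mathbb{D}}\frac{w+z}{w-z}\,d\mu(w)$; for $z\in\partial\mathbb{D}\setminus\operatorname{supp}\mu$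 one has $iF_\mu(z)\in\mathbb{R}$. Nikishin system of two measures on the unit circle. $(\mu_1,\mu_2)\in\mathcal{M}(\partial\mathbb{D})^2$ is a Nikishin system generated by $(\sigma_1,\sigma_2)$, written $(\mu_1,\mu_2)=\mathcal{N}(\sigma_1,\sigma_2)$, if there are arcs $\Gamma_1,\Gamma_2$ with $\mathring{\Gamma}_1\cap\mathring{\Gamma}_2=\varnothing$ and $\partial\mathbb{D}\setminus(\Gamma_1\cup\Gamma_2)\ne\varnothing$, and measures $\sigma_1\in\mathcal{M}(\Gamma_1)$, $\sigma_2\in\mathcal{M}(\Gamma_2)$, such that $\mu_1=\sigma_1$ and $d\mu_2(z)=iF_{\sigma_2}(z)\,d\sigma_1(z)$. When the arcs share an endpoint, it is part of the assumption that the latter is a well-defined finite measure. If at a common endpoint of $\Gamma_1$ and $\Gamma_2$ the integral defining $F_{\sigma_2}$ does not converge absolutely, the hypothesis ''$F_{\sigma_2}\ne0$ on $\Gamma_1$'' is understood on the rest of $\Gamma_1$. $\phi$-normality. An index $\bm{n}=(n_1,n_2)\in\mathbb{N}^2$ is $\phi$-normal with respect to $(\mu_1,\mu_2)$ if there is a unique function of the form $\phi_{\bm{n}}(z)=z^{|\bm{n}|/2}+\kappa_{|\bm{n}|/2-1}z^{|\bm{n}|/2-1}+\cdots+\kappa_{-|\bm{n}|/2}z^{-|\bm{n}|/2}$ (exponents decreasing in steps of $1$, complex coefficients) satisfying, for $j=1,2$, $\int\phi_{\bm{n}}(z)z^{-k}\,d\mu_j(z)=0$ for $k=-n_j/2,-n_j/2+1,\ldots,n_j/2-1$.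 *)

(* Defs.v *)
From HB Require Import structures.
From mathcomp Require Import all_boot all_order all_algebra.
From mathcomp Require Import all_classical all_reals all_analysis.
From mathcomp Require Import complex.

Set Implicit Arguments.
Unset Strict Implicit.
Unset Printing Implicit Defensive.

Import Order.TTheory GRing.Theory Num.Theory.
Import numFieldNormedType.Exports.

Local Open Scope classical_set_scope.
Local Open Scope ring_scope.
Local Open Scope complex_scope.

Definition cis (R : realType) (t : R) : R[i] := cos t +i* sin t.

Definition circle (R : realType) : set R[i] := [set z | `|z| = 1].
Arguments circle R : clear implicits.

Record circle_arc (R : realType) := Arc {
  arc_lo : R;
  arc_hi : R;
  arc_len : 0 < arc_hi - arc_lo <= 2 * pi }.

Definition arc_set (R : realType) (G : circle_arc R) : set R[i] :=
  [set cis t | t in `[arc_lo G, arc_hi G]].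

Definition arc_ends (R : realType) (G : circle_arc R) : set R[i] :=
  [set cis (arc_lo G); cis (arc_hi G)].

(* Interior relative to the unit circle, not to the plane. *)
Definition circle_interior (R : realType) (A : set R[i]) : set R[i] :=
  [set z | circle R z /\
     \forall w \near within (circle R) (nbhs (z : R[i]^o)), A w].

(* The complex plane with its Borel sigma-algebra. *)
Definition borelC (R : realType) := g_sigma_algebraType (@open R[i]^o).

(* A finite Borel measure of constant sign, stored as its sign (csneg = true for
   a negative measure) and its absolute value.  It lives on the plane; being a
   measure on the circle is a condition on its support, see in_M. *)
Record csmeasure (R : realType) := CSMeasure {
  csneg : bool;
  csabs : {finite_measure set (borelC R) -> \bar R} }.

Definition csval (R : realType) (mu : csmeasure R) (A : set (borelC R)) : R :=
  (-1) ^+ csneg mu * fine (csabs mu A).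

Definition cssupp (R : realType) (mu : csmeasure R) : set R[i] :=
  [set z | forall U : set R[i]^o, open U -> U z -> (0 < csabs mu U)%E].

(* The class M(G).  The plane being second countable, a measure whose support
   lies in a subset of the circle is carried by the circle. *)
Definition in_M (R : realType) (G : set R[i]) (mu : csmeasure R) : Prop :=
  infinite_set (cssupp mu) /\ cssupp mu `<=` G.

Definition csintegrable (R : realType) (mu : csmeasure R) (D : set (borelC R))
    (f : borelC R -> R[i]) : Prop :=
  (csabs mu).-integrable D (fun z => (complex.Re (f z))%:E) /\
  (csabs mu).-integrable D (fun z => (complex.Im (f z))%:E).

Definition csintegral (R : realType) (mu : csmeasure R) (D : set (borelC R))
    (f : borelC R -> R[i]) : R[i] :=
  (-1) ^+ csneg mu *
  (Rintegral (csabs mu) D (fun z => complex.Re (f z)) +i*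
   Rintegral (csabs mu) D (fun z => complex.Im (f z))).

Definition cara_kernel (R : realType) (z w : R[i]) : R[i] := (w + z) / (w - z).

Definition cara (R : realType) (mu : csmeasure R) (z : R[i]) : R[i] :=
  csintegral mu (circle R) (cara_kernel z).

(* Absolute convergence of the integral defining cara mu z.  An atom of mu at z
   makes it diverge, which integrability alone would miss since the kernel takes
   the junk value 0 at w = z. *)
Definition cara_converges (R : realType) (mu : csmeasure R) (z : R[i]) : Prop :=
  csabs mu [set z] = 0%E /\ csintegrable mu (circle R) (cara_kernel z).

(* (mu1, mu2) = N(s1, s2) with associated arcs G1 and G2.  The fields
   nikishin_conv and nikishin_int say that i F_{s2} ds1 is a well-defined finite
   measure; they can only fail when the arcs share an endpoint. *)
Record nikishin (R : realType) (G1 G2 : circle_arc R)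
    (s1 s2 mu1 mu2 : csmeasure R) : Prop := Nikishin {
  nikishin_disj : circle_interior (arc_set G1) `&`
                  circle_interior (arc_set G2) = set0;
  nikishin_gap : circle R `\` (arc_set G1 `|` arc_set G2) !=set0;
  nikishin_s1 : in_M (arc_set G1) s1;
  nikishin_s2 : in_M (arc_set G2) s2;
  nikishin_mu1 : in_M (circle R) mu1;
  nikishin_mu2 : in_M (circle R) mu2;
  nikishin_mu1E : forall A : set (borelC R), measurable A -> A `<=` circle R ->
    csval mu1 A = csval s1 A;
  nikishin_conv : {ae csabs s1, forall z, cara_converges s2 z};
  nikishin_int : csintegrable s1 (circle R) (fun z => (0 +i* 1) * cara s2 z);
  nikishin_mu2E : forall A : set (borelC R), measurable A -> A `<=` circle R ->
    (csval mu2 A)%:C = csintegral s1 A (fun z => (0 +i* 1) * cara s2 z) }.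

(* F_{s2} <> 0 on G1, ignoring the common endpoints at which the defining
   integral does not converge absolutely. *)
Definition cara_nonzero_on (R : realType) (G1 G2 : circle_arc R)
    (s2 : csmeasure R) : Prop :=
  forall z : R[i], arc_set G1 z ->
    (arc_ends G1 z /\ arc_ends G2 z -> cara_converges s2 z) ->
    cara s2 z <> 0.

(* The argument of z in [t0, t0 + 2 pi); for z = 0 its value is irrelevant. *)
Definition argC (R : realType) (t0 : R) (z : R[i]) : R :=
  xget t0 [set t : R | t0 <= t < t0 + 2 * pi /\ z = `|z| * cis t].

Definition sqrtC_cut (R : realType) (t0 : R) (z : R[i]) : R[i] :=
  (Num.sqrt (complex.Re `|z|))%:C * cis (argC t0 z / 2).

(* z^(k/2) is hpow t0 k z. *)
Definition hpow (R : realType) (t0 : R) (k : int) (z : R[i]) : R[i] :=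
  sqrtC_cut t0 z ^ k.

(* z^(N/2) + kappa_0 z^(N/2-1) + ... + kappa_(N-1) z^(-N/2) *)
Definition phi_form (R : realType) (t0 : R) (N : nat) (kappa : 'I_N -> R[i])
    (z : R[i]) : R[i] :=
  hpow t0 N%:Z z +
  \sum_(j < N) kappa j * hpow t0 (N%:Z - (j.+1).*2%:Z) z.

(* Orthogonality to z^k for k = -n/2, -n/2+1, ..., n/2-1, i.e. k = l - n/2 with
   0 <= l < n. *)
Definition phi_orthogonal (R : realType) (t0 : R) (n : nat) (mu : csmeasure R)
    (phi : R[i] -> R[i]) : Prop :=
  forall l : nat, (l < n)%N ->
    csintegral mu (circle R)
      (fun z => phi z * hpow t0 (- (l.*2%:Z - n%:Z)) z) = 0.

Definition phi_normal (R : realType) (t0 : R) (n1 n2 : nat)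
    (mu1 mu2 : csmeasure R) : Prop :=
  exists! phi : R[i] -> R[i],
    [/\ exists kappa : 'I_(n1 + n2) -> R[i], phi = phi_form t0 kappa,
        phi_orthogonal t0 n1 mu1 phi
      & phi_orthogonal t0 n2 mu2 phi].

(* Main.v *)
(* The Cayley transform sends e^(i t0) to infinity and turns the system into one for
   polynomials on the real line, where i F becomes a Markov function
   f(x) = int (1 + x y) / (x - y) d sigma_2(y).  If the square linear system for the
   coefficients of phi were singular, its transpose would have a nontrivial solution:
   a function g = a w^(-p) + b w^(-q) f, with w = 1 + x^2 and a, b real polynomials of
   degrees < n1, < n2, such that g d sigma_1 annihilates all polynomials of degree
   < N = n1 + n2 (up to a common positive weight).  Were g to have fewer than N zeros,
   some polynomial of degree < N would have the sign of g throughout, a contradiction.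

   So it remains to exclude N zeros x_i of g on Gamma_1.  Let c_i = 1 / prod (x_i - x_j).
   Then sum c_i Q(x_i) = 0 for deg Q <= N - 2, and by partial fractions
   sum c_i f(x_i) Q(x_i) = - int (1 + y^2) Q(y) / prod (y - x_j) d sigma_2(y), where the
   denominator is positive on Gamma_2 because N is even.  For n2 <= n1 the choice
   Q = b^2 w^((n1-n2)/2) makes the left side vanish, hence b = 0.  For n1 < n2 the
   hypothesis F <> 0 gives f a constant sign on Gamma_1, so that the quadratic form
   with weights c_i f(x_i) w_i^((n1-n2)/2) has signature (N/2, N/2); it is definite on a
   space of dimension N/2, to which the isotropic vector (b(x_i)) is orthogonal; hence
   again b = 0. *)
Require Import Defs.
From HB Require Import structures.
From mathcomp Require Import all_boot all_order all_algebra.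
From mathcomp Require Import all_classical all_reals all_analysis.
From mathcomp Require Import complex.
From mathcomp Require Import measurable_realfun ring lra zify.

Set Implicit Arguments.
Unset Strict Implicit.
Unset Printing Implicit Defensive.

Import Order.TTheory GRing.Theory Num.Theory.
Import numFieldNormedType.Exports.

Local Open Scope ring_scope.

(** * Lagrange interpolation and the Chebyshev property of the pair of spaces *)

(** Existence and uniqueness of phi are the invertibility of one square matrix, so only its kernel
    has to be studied; the moments are real, hence a and b may be taken real. Both parity cases
    enter through the evenness of N: it makes prod (y - x_j) positive on whichever side of Gamma_1
    the point y lies, and it makes p - q = (n1 - n2)/2 an integer, so that the quotient of the two
    weights is a power of w without square roots. The case n1 < n2 is harder because w^((n1-n2)/2)
    is then no polynomial and cannot be absorbed into Q. The factor (x + i)^d, d = (n2-n1)/2, with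
    squared modulus w^d, cancels this denominator: on its multiples (x + i)^d v the form becomes sum
    c_i f(x_i) |v(x_i)|^2, where |v|^2 is again a nonnegative polynomial of admissible degree. At an
    endpoint common to both arcs f need not exist. Gamma_1 is therefore replaced by the interval E
    of those of its points where the integral converges; E still carries sigma_1 and is null for
    sigma_2. *)

Definition node_weight (F : fieldType) (n : nat) (x : 'I_n -> F) (i : 'I_n) : F :=
  \prod_(j < n | j != i) (x i - x j)^-1.

Lemma poly_eq0_nodes (F : fieldType) (n : nat) (x : 'I_n -> F) (p : {poly F}) :
  injective x -> (size p <= n)%N -> (forall i, p.[x i] = 0) -> p = 0.
Proof.
move=> xinj sp p0; apply: (@roots_geq_poly_eq0 _ p (map x (enum 'I_n))).
- by apply/allP => _ /mapP[i _ ->]; apply/rootP.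
- by rewrite map_inj_uniq ?enum_uniq.
- by rewrite size_map size_enum_ord.
Qed.

Lemma size_polyM_le (F : idomainType) (p q : {poly F}) (k m : nat) :
  (size p <= k.+1)%N -> (size q <= m)%N -> (size (p * q)%R <= k + m)%N.
Proof. by move=> sp sq; rewrite (leq_trans (size_polyMleq _ _))//; lia. Qed.

Lemma lagrange_expansion (F : fieldType) (n : nat) (x : 'I_n -> F) (p : {poly F}) :
  injective x -> (size p <= n)%N ->
  p = \sum_(i < n) (node_weight x i * p.[x i]) *:
        \prod_(j < n | j != i) ('X - (x j)%:P).
Proof.
move=> xinj sp; apply/eqP; rewrite -subr_eq0; apply/eqP.
apply: (poly_eq0_nodes xinj).
  rewrite (leq_trans (size_polyD _ _))// geq_max sp size_polyN/=.
  apply: (leq_trans (size_sum _ _ _)); apply/bigmax_leqP => i _.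
  rewrite (leq_trans (size_scale_leq _ _))// size_prod; last first.
    by move=> j _; rewrite polyXsubC_eq0.
  rewrite (eq_bigr (fun=> 2%N)); last by move=> j _; rewrite size_XsubC.
  rewrite sum_nat_const cardC1 card_ord.
  by have := ltn_ord i; lia.
move=> k; rewrite hornerD hornerN horner_sum (bigD1 k)//= [X in _ - (_ + X)]big1 ?addr0.
  rewrite hornerZ. rewrite horner_prod /node_weight -mulrA mulrC -mulrA -big_split/=.
  rewrite [X in _ * X]big1 ?mulr1 ?subrr// => j jk.
  rewrite hornerXsubC divff// subr_eq0; apply/negP => /eqP /xinj kj.
  by rewrite kj eqxx in jk.
move=> i ik; rewrite hornerZ horner_prod (bigD1 k)/=; last by rewrite eq_sym.
by rewrite hornerXsubC subrr mul0r mulr0.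
Qed.

Lemma partial_fractions (F : fieldType) (n : nat) (x : 'I_n -> F) (p : {poly F})
    (y : F) :
  injective x -> (size p <= n)%N -> (forall i, y != x i) ->
  \sum_(i < n) node_weight x i * p.[x i] / (y - x i) =
  p.[y] / \prod_(j < n) (y - x j).
Proof.
move=> xinj sp ynx; rewrite {2}(lagrange_expansion xinj sp) horner_sum mulr_suml.
apply: eq_bigr => i _; rewrite hornerZ -!mulrA; congr (_ * (_ * _)).
have yx j : y - x j != 0 by rewrite subr_eq0.
rewrite horner_prod; under eq_bigr do rewrite hornerXsubC.
rewrite [X in _ / X](bigD1 i)//= invfM mulrCA divff ?mulr1//.
by apply/prodf_neq0 => j _.
Qed.

Lemma infinite_numField (F : numFieldType) (s : seq F) : exists y, y \notin s.
Proof.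
exists (1 + \sum_(z <- s) `|z|); apply/negP => ys.
have h0 : forall r : seq F, 0 <= \sum_(z <- r) `|z| by move=> r; rewrite sumr_ge0.
have : `|1 + \sum_(z <- s) `|z| | <= \sum_(z <- s) `|z|.
  move: (1 + _) ys => y; elim: s => //= z s IH.
  rewrite inE big_cons => /predU1P[->|/IH h]; first by rewrite lerDl.
  by rewrite (le_trans h)// lerDr.
by rewrite ger0_norm ?addr_ge0// gerDr ler10.
Qed.

Lemma divided_difference_eq0 (F : numFieldType) (n : nat) (x : 'I_n -> F)
    (p : {poly F}) :
  injective x -> (size p < n)%N -> \sum_(i < n) node_weight x i * p.[x i] = 0.
Proof.
move=> xinj sp.
have [y ynx] := infinite_numField (map x (enum 'I_n)).
have {}ynx i : y != x i.
  by apply: contra ynx => /eqP ->; apply: map_f; rewrite mem_enum.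
(* The factor X - y makes the right side of the partial fractions vanish at y, and at each node it
   cancels the denominator y - x_i up to sign. *)
have sp1 : (size (p * ('X - y%:P))%R <= n)%N.
  by rewrite (leq_trans (size_polyMleq _ _))// size_XsubC addn2/=.
have := partial_fractions xinj sp1 ynx.
rewrite hornerM hornerXsubC subrr mulr0 mul0r => /eqP.
rewrite -oppr_eq0 -sumrN => /eqP h; rewrite -[RHS]h; apply: eq_bigr => i _.
rewrite hornerM hornerXsubC; field.
by rewrite subr_eq0.
Qed.

Lemma node_weight_neq0 (F : fieldType) (n : nat) (x : 'I_n -> F) (i : 'I_n) :
  injective x -> node_weight x i != 0.
Proof.
move=> xinj; apply/prodf_neq0 => j ji; rewrite invr_eq0 subr_eq0.
by apply: contra ji => /eqP /xinj ->.
Qed.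

Lemma interpolation (F : fieldType) (s : seq F) (g : F -> F) :
  uniq s -> exists p : {poly F},
    (size p <= size s)%N /\ {in s, forall z, p.[z] = g z}.
Proof.
elim: s => [|z s IH]; first by exists 0; rewrite size_poly0.
move=> /= /andP[zs /IH[p [sp pg]]].
pose w : {poly F} := \prod_(t <- s) ('X - t%:P).
have wz : w.[z] != 0 by rewrite -[_ == 0]/(root w z) root_prod_XsubC.
exists (p + ((g z - p.[z]) / w.[z]) *: w); split.
  rewrite (leq_trans (size_polyD _ _))// geq_max (leq_trans sp)//=.
  by rewrite (leq_trans (size_scale_leq _ _))// size_prod_XsubC.
move=> t; rewrite inE hornerD hornerZ => /predU1P[->|ts]; first by field.
have /rootP -> : root w t by rewrite root_prod_XsubC.
by rewrite mulr0 addr0 pg.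
Qed.

(* Polynomials of degree < M form an isotropic subspace of dimension M for the form
   sum_i c_i u_i v_i, whose signature is therefore (M, M). *)
Lemma card_node_weight_lt0 (F : realFieldType) (M : nat) (x : 'I_M.*2 -> F)
    (e : F) :
  injective x -> (#|[set i | (node_weight x i * e < 0)%R]| <= M)%N.
Proof.
move=> xinj; have [->|e0] := eqVneq e 0.
  by rewrite (@eq_card0 _ _)// => i; rewrite inE mulr0 ltxx.
set T := [set i | _]; rewrite leqNgt; apply/negP => MT.
pose S := ~: T.
have cS : (#|S| < M)%N.
  by have := cardsC T; rewrite card_ord -/S => h; lia.
(* w vanishes at the nodes outside T. If T had more than M elements, w^2 would have degree at most
   2M - 2, while all terms e c_i w(x_i)^2 of its divided difference would be nonpositive. *)
pose w : {poly F} := \prod_(i in S) ('X - (x i)%:P).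
have sw : size w = #|S|.+1.
  rewrite /w size_prod; last by move=> j _; rewrite polyXsubC_eq0.
  rewrite (eq_bigr (fun=> 2%N)); last by move=> j _; rewrite size_XsubC.
  by rewrite sum_nat_const muln2 -addnn -addSn addnK.
have /(divided_difference_eq0 xinj) : (size (w ^+ 2)%R < M.*2)%N.
  by rewrite (leq_ltn_trans (size_polyMleq _ _))// sw; lia.
move=> /(congr1 ( *%R^~ e)); rewrite mul0r mulr_suml => /eqP.
rewrite -oppr_eq0 -sumrN psumr_eq0; last first.
  move=> i _; rewrite oppr_ge0 mulrAC horner_exp.
  have [iT|] := boolP (i \in T).
    by rewrite mulr_le0_ge0 ?sqr_ge0//; move: iT; rewrite inE => /ltW.
  rewrite -finset.in_setC => iS; rewrite /w horner_prod (bigD1 i)//= hornerXsubC.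
  by rewrite subrr mul0r expr0n mulr0.
move=> /allP h; have : w = 0.
  apply: (poly_eq0_nodes xinj) => [|i]; first by rewrite sw; lia.
  have := h i (mem_index_enum _); rewrite oppr_eq0 !mulf_eq0 (negPf e0) orbF.
  by rewrite (negPf (node_weight_neq0 _ xinj))/= horner_exp expf_eq0/= => /eqP.
by move=> w0; move: sw; rewrite w0 size_poly0.
Qed.

(* (x + i)^d = p + i q. *)
Lemma sum_two_squares_exp (F : realFieldType) (d : nat) :
  exists p q : {poly F},
    [/\ (size p <= d.+1)%N, (size q <= d.+1)%N
      & p ^+ 2 + q ^+ 2 = (1 + 'X ^+ 2) ^+ d].
Proof.
elim: d => [|d [p [q [sp sq pq]]]].
  by exists 1, 0; rewrite size_poly1 size_poly0 expr0 expr1n expr0n addr0.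
exists ('X * p - q), ('X * q + p); split; last by rewrite [RHS]exprS -pq; ring.
- rewrite (leq_trans (size_polyD _ _))// geq_max size_polyN.
  rewrite (leq_trans (size_polyMleq _ _)) ?size_polyX//= (leq_trans sq)//.
- rewrite (leq_trans (size_polyD _ _))// geq_max.
  rewrite (leq_trans (size_polyMleq _ _)) ?size_polyX//= (leq_trans sp)//.
Qed.

Lemma sum_sqr_poly_eq0 (F : realFieldType) (u v : {poly F}) :
  u ^+ 2 + v ^+ 2 = 0 -> u = 0 /\ v = 0.
Proof.
move=> uv0.
have h y : u.[y] = 0 /\ v.[y] = 0.
  have /(congr1 (fun p : {poly F} => p.[y])) := uv0.
  rewrite hornerD !horner_exp horner0 => /eqP.
  by rewrite paddr_eq0 ?sqr_ge0// !sqrf_eq0 => /andP[/eqP ? /eqP ?].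
have z (p : {poly F}) : (forall y, p.[y] = 0) -> p = 0.
  move=> p0; have inj : injective (fun i : 'I_(size p) => (val i)%:R : F).
    by move=> i j /eqP; rewrite eqr_nat => /eqP /val_inj.
  exact: (poly_eq0_nodes inj).
by split; apply: z => y; have [] := h y.
Qed.

Lemma size_quad_exp (F : realFieldType) (d : nat) :
  (size ((1 + 'X ^+ 2 : {poly F}) ^+ d)%R <= d.*2.+1)%N.
Proof.
rewrite (leq_trans (size_poly_exp_leq _ _))//.
have : (size (1 + 'X ^+ 2 : {poly F})%R <= 3)%N.
  by rewrite (leq_trans (size_polyD _ _))// size_poly1 size_polyXn.
by case: (size _) => [|k]/= h; nia.
Qed.

(** The sum equals minus an integral of Q against a positive weight (see
    [positive_functional_markov]), hence is negative for nonzero Q >= 0. The contrapositive form is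
    the one applied below. *)
Definition positive_functional (F : realFieldType) (n : nat) (x f : 'I_n -> F) :=
  forall Q : {poly F}, (size Q < n)%N -> (forall y, 0 <= Q.[y]) ->
    0 <= \sum_(i < n) node_weight x i * f i * Q.[x i] -> Q = 0.

Lemma nikishin_system_ge (F : realFieldType) (N n1 n2 d : nat)
    (x f : 'I_N -> F) (a b : {poly F}) :
  injective x -> N = (n1 + n2)%N -> positive_functional x f -> n1 = (n2 + d.*2)%N ->
  (size a <= n1)%N -> (size b <= n2)%N ->
  (forall i, a.[x i] + f i * b.[x i] * (1 + x i ^+ 2) ^+ d = 0) ->
  a = 0 /\ b = 0.
Proof.
move=> xinj Nn posf n12 sa sb eqn.
have b0 : b = 0.
  apply/eqP; rewrite -[b == 0]negbK; apply/negP => b0.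
  have nb : (0 < size b)%N by rewrite size_poly_gt0.
  suff : b ^+ 2 * (1 + 'X ^+ 2) ^+ d = 0.
    move/eqP; rewrite mulf_eq0 expf_eq0/= (negPf b0)/= expf_eq0 => /andP[_ /eqP].
    move=> /(congr1 (fun p : {poly F} => p.[0])); rewrite !hornerE => /eqP.
    by rewrite expr0n addr0 oner_eq0.
  apply: posf.
  - rewrite (leq_ltn_trans (size_polyMleq _ _))//.
    have := size_quad_exp F d; have : (size (b ^+ 2)%R <= (size b).*2.-1)%N.
      by rewrite (leq_trans (size_polyMleq _ _))// addnn.
    by lia.
  - move=> y; rewrite hornerM horner_exp mulr_ge0 ?sqr_ge0//.
    by rewrite horner_exp exprn_ge0// !hornerE addr_ge0// sqr_ge0.
  (* At the nodes f b^2 w^d = - a b, and a b has degree at most N - 2, so its divided difference is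
     zero. *)
  - have sab : (size (a * b)%R < N)%N.
      by rewrite (leq_ltn_trans (size_polyMleq _ _))//; lia.
    have ab := divided_difference_eq0 xinj sab.
    rewrite le_eqVlt; apply/orP; left; rewrite eq_sym -oppr_eq0 -sumrN -[X in _ == X]ab.
    apply/eqP; apply: eq_bigr => i _; rewrite !hornerM !horner_exp !hornerE.
    have /eqP := eqn i; rewrite addr_eq0 => /eqP -> /=; ring.
split=> //; apply: (poly_eq0_nodes xinj) => [|i]; first by rewrite Nn (leq_trans sa)// leq_addr.
by have := eqn i; rewrite b0 horner0 mulr0 mul0r addr0.
Qed.

(* On the span of the polynomials (X + i)^d v with deg v < M the Hermitian form
   sum_i c_i f_i w_i^(-d) |u_i|^2, w = 1 + x^2, is negative definite; b is isotropic
   and orthogonal to that span, which has the dimension M of a maximal definite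
   subspace. *)
Lemma nikishin_system_lt (F : realFieldType) (M n1 n2 d : nat)
    (x f : 'I_M.*2 -> F) (a b : {poly F}) (e : F) :
  injective x -> positive_functional x f -> M = (n1 + d)%N -> n2 = (M + d)%N ->
  (forall i, 0 < f i * e) ->
  (size a <= n1)%N -> (size b <= n2)%N ->
  (forall i, a.[x i] * (1 + x i ^+ 2) ^+ d + f i * b.[x i] = 0) ->
  a = 0 /\ b = 0.
Proof.
move=> xinj posf Mn n2M fe sa sb eqn.
have w0 i : (1 + x i ^+ 2) ^+ d != 0.
  by rewrite expf_neq0// gt_eqF// ltr_pwDl ?sqr_ge0.
have saM : (size a <= M.*2)%N by lia.
have sbM : (size b <= M.*2)%N by lia.
have [b0|b0] := eqVneq b 0.
  split=> //; apply: (poly_eq0_nodes xinj saM) => i.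
  have := eqn i; rewrite b0 horner0 mulr0 addr0 => /eqP.
  by rewrite mulf_eq0 (negPf (w0 i)) orbF => /eqP.
exfalso; have nb : (0 < size b)%N by rewrite size_poly_gt0.
have [p [q [sp sq pq]]] := sum_two_squares_exp F d.
have pqE y : p.[y] ^+ 2 + q.[y] ^+ 2 = (1 + y ^+ 2) ^+ d.
  have /(congr1 (fun p : {poly F} => p.[y])) := pq.
  by rewrite hornerD !horner_exp !hornerE.
(* As f has the constant sign of e, these are the nodes where c_i f_i is negative. *)
pose s := [seq x i | i <- enum [set i | (node_weight x i * e < 0)%R]].
have us : uniq s by rewrite map_inj_uniq ?enum_uniq.
have ss : (size s <= M)%N.
  by rewrite size_map -cardE; exact: card_node_weight_lt0.
have [v1 [sv1 v1E]] := interpolation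
  (fun y => b.[y] * p.[y] / (1 + y ^+ 2) ^+ d) us.
have [v2 [sv2 v2E]] := interpolation
  (fun y => - b.[y] * q.[y] / (1 + y ^+ 2) ^+ d) us.
(* u + i u' = (p + i q)(v1 + i v2), and v1 + i v2 interpolates b / (p + i q) on s; hence u + i u'
   agrees with b there. *)
pose u := p * v1 - q * v2.
pose u' := p * v2 + q * v1.
have su : (size u <= n2)%N.
  rewrite (leq_trans (size_polyD _ _))// geq_max size_polyN.
  by rewrite n2M addnC !size_polyM_le// (leq_trans _ ss).
have uE i : x i \in s -> u.[x i] = b.[x i] /\ u'.[x i] = 0.
  move=> xs; rewrite !hornerE v1E// v2E//; split; last by field.
  rewrite -[RHS](mulfK (w0 i)) -{3}pqE; field; exact: w0.
(* c_i f_i w^(-d) |u + i u' - b|^2, which vanishes on s and is nonnegative at the other nodes. *)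
pose g i := node_weight x i * f i / (1 + x i ^+ 2) ^+ d *
  ((u.[x i] - b.[x i]) ^+ 2 + u'.[x i] ^+ 2).
have g0 i : 0 <= g i.
  have [xs|xs] := boolP (x i \in s).
    by rewrite /g; have [-> ->] := uE i xs; rewrite subrr expr0n addr0 mulr0.
  apply: mulr_ge0; last by rewrite addr_ge0 ?sqr_ge0.
  rewrite divr_ge0 ?exprn_ge0 ?addr_ge0 ?sqr_ge0//.
  have : 0 <= node_weight x i * e.
    by rewrite leNgt; apply: contra xs => h; rewrite map_f// mem_enum inE.
  have := fe i; have [e0|e0|->] := ltrgtP e 0; last by rewrite mulr0 ltxx.
  - by rewrite nmulr_lgt0// nmulr_lge0// => /ltW /[swap]; exact: mulr_le0.
  - by rewrite pmulr_lgt0// pmulr_lge0// => /ltW /[swap]; exact: mulr_ge0.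
have gsum : \sum_i g i = \sum_i node_weight x i * f i * (v1 ^+ 2 + v2 ^+ 2).[x i].
  have sau : (size (a * u)%R < M.*2)%N.
    by rewrite (leq_ltn_trans (size_polyMleq _ _))//; lia.
  have sab : (size (a * b)%R < M.*2)%N.
    by rewrite (leq_ltn_trans (size_polyMleq _ _))//; lia.
  have au := divided_difference_eq0 xinj sau.
  have ab := divided_difference_eq0 xinj sab.
  (* Expansion of the square: as f b = - a w^d at the nodes, the mixed term becomes 2 c_i (a u)(x_i)
     and the square of b becomes - c_i (a b)(x_i). Both sum to zero by their degrees. *)
  transitivity (\sum_i (node_weight x i * f i * (v1 ^+ 2 + v2 ^+ 2).[x i]
    + 2 * (node_weight x i * (a * u).[x i]) - node_weight x i * (a * b).[x i])).
    apply: eq_bigr => i _.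
    have -> : (a * u).[x i] = - (f i * b.[x i] / (1 + x i ^+ 2) ^+ d) * u.[x i].
      rewrite hornerM; congr (_ * _); apply: (mulIf (w0 i)).
      by rewrite mulNr divfK//; apply/eqP; rewrite -addr_eq0 eqn.
    have -> : (a * b).[x i] = - (f i * b.[x i] / (1 + x i ^+ 2) ^+ d) * b.[x i].
      rewrite hornerM; congr (_ * _); apply: (mulIf (w0 i)).
      by rewrite mulNr divfK//; apply/eqP; rewrite -addr_eq0 eqn.
    have uu : u.[x i] ^+ 2 + u'.[x i] ^+ 2 =
        (1 + x i ^+ 2) ^+ d * (v1 ^+ 2 + v2 ^+ 2).[x i].
      by rewrite -pqE !hornerE; ring.
    have -> : (v1 ^+ 2 + v2 ^+ 2).[x i] =
        (u.[x i] ^+ 2 + u'.[x i] ^+ 2) / (1 + x i ^+ 2) ^+ d.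
      by rewrite uu mulrAC divff// mul1r.
    by rewrite /g; field; exact: w0.
  by rewrite big_split sumrN big_split/= -mulr_sumr au ab mulr0 subr0 addr0.
have /sum_sqr_poly_eq0[v10 v20] : v1 ^+ 2 + v2 ^+ 2 = 0.
  apply: posf; last by rewrite -gsum sumr_ge0.
  - have h (v : {poly F}) : (size v <= size s)%N -> (size (v ^+ 2)%R < M.*2)%N.
      by move=> sv; rewrite (leq_ltn_trans (size_polyMleq _ _))//; lia.
    by rewrite (leq_ltn_trans (size_polyD _ _))// gtn_max !h.
  - by move=> y; rewrite hornerD !horner_exp addr_ge0 ?sqr_ge0.
have : \sum_i g i = 0.
  rewrite gsum v10 v20 big1// => i _.
  by rewrite expr0n addr0 horner0 mulr0.
move/eqP; rewrite psumr_eq0// => /allP gi0.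
case/negP: b0; apply/eqP; apply: (poly_eq0_nodes xinj sbM) => i.
have f0 : f i != 0 by apply/eqP => fi0; have := fe i; rewrite fi0 mul0r ltxx.
have := gi0 i (mem_index_enum _); rewrite /g /u /u' v10 v20 !mulr0 subr0 addr0.
rewrite horner0 sub0r expr0n addr0 sqrrN !mulf_eq0 invr_eq0 (negPf (w0 i)) orbF.
by rewrite (negPf f0) (negPf (node_weight_neq0 _ xinj))/= orbb => /eqP.
Qed.

Local Open Scope classical_set_scope.
Local Open Scope ring_scope.

(** * Polynomials that match the sign of a function with few zeros *)

Lemma finite_sorted_enum (R : realType) (P : R -> Prop) (n : nat) :
  (forall s : seq R, uniq s -> (forall x, x \in s -> P x) -> (size s < n)%N) ->
  exists zs : seq R,
    [/\ sorted <%R zs, (size zs < n)%N & forall x, x \in zs <-> P x].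
Proof.
move=> Pn.
suff [s [us Ps sP]] : exists s : seq R,
    [/\ uniq s, forall x, x \in s -> P x & forall x, P x -> x \in s].
  exists (sort <=%R s); split; first by rewrite sort_lt_sorted.
    by rewrite size_sort; exact: Pn.
  by move=> x; rewrite mem_sort; split; [exact: Ps|exact: sP].
(* k is the room left below the forbidden length n; a list that cannot be extended contains every
   point. *)
have ext k : forall s : seq R, uniq s -> (forall x, x \in s -> P x) ->
    (size s + k = n)%N -> exists s : seq R,
    [/\ uniq s, forall x, x \in s -> P x & forall x, P x -> x \in s].
  elim: k => [|k IH] s us Ps sk.
    by have := Pn s us Ps; rewrite -sk addn0 ltnn.
  have [sP|/existsNP[x /not_implyP[Px /negP xs]]] :=
    pselect (forall x, P x -> x \in s); first by exists s.
  apply: (IH (x :: s)); rewrite /= ?xs//; last by rewrite -sk addnS.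
  by move=> y; rewrite inE => /predU1P[->//|]; exact: Ps.
by apply: (ext n [::]).
Qed.

(** All that the sign argument retains of continuity; it is inherited by the part of E to the left
    of a point. *)
Definition ivt_on (R : realType) (E : set R) (g : R -> R) :=
  forall a b, E a -> E b -> a < b -> g a * g b < 0 ->
    exists2 c, E c /\ a < c < b & g c = 0.

(** Q is a product of X - z over zeros z at which g changes sign. The zeros are removed from the
    right: E is cut at the last one, and the positivity of Q beyond all zeros, carried through the
    induction, gives the sign of Q there. *)
Lemma sign_polynomial (R : realType) (E : set R) (g : R -> R) (zs : seq R) :
  ivt_on E g -> sorted <%R zs -> (forall z, z \in zs -> g z = 0) ->
  (forall x, E x -> g x = 0 -> x \in zs) ->
  exists (Q : {poly R}) (e : R), [/\ (size Q <= (size zs).+1)%N, e != 0,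
    forall x, E x -> 0 <= e * g x * Q.[x] &
    forall x, all (< x) zs -> 0 < Q.[x]].
Proof.
elim/last_ind: zs E => [|zs z IH] E ivt.
  move=> _ _ gE; have [[x0 Ex0]|E0] := pselect (exists x, E x); last first.
    exists 1, 1; split; rewrite ?size_poly1 ?oner_neq0// => x.
      by move=> Ex; exfalso; apply: E0; exists x.
    by rewrite hornerC ltr01.
  have g0 x : E x -> g x != 0 by move=> Ex; apply/eqP => /(gE _ Ex).
  exists 1, (g x0); split; rewrite ?size_poly1 ?g0// => x; last first.
    by rewrite hornerC ltr01.
  move=> Ex; rewrite hornerC mulr1 leNgt; apply/negP => h.
  have [xx0|xx0|xx0] := ltrgtP x x0.
  - rewrite mulrC in h; have [c [Ec _] /(gE _ Ec)//] := ivt _ _ Ex Ex0 xx0 h.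
  - by have [c [Ec _] /(gE _ Ec)//] := ivt _ _ Ex0 Ex xx0 h.
  - by move: h; rewrite xx0 ltNge sqr_ge0.
move=> szs gz gE.
have [szs' zsz] : sorted <%R zs /\ all (< z) zs.
  move: szs; rewrite -cats1 lt_sorted_pairwise pairwise_cat allrel1r/= => /and3P[].
  by rewrite lt_sorted_pairwise.
have gz0 : g z = 0 by apply: gz; rewrite mem_rcons mem_head.
have [||y yzs|x [Ex xz] gx|Q [e [sQ e0 Qg Qpos]]] := IH (E `&` [set x | x < z]) => //.
- move=> a b [Ea az] [Eb bz] ab gab.
  have [c [Ec /andP[ac cb]] gc] := ivt _ _ Ea Eb ab gab.
  exists c => //; split; last by rewrite ac.
  by split=> //; apply: (lt_trans cb).
- by apply: gz; rewrite mem_rcons inE yzs orbT.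
- have := gE x Ex gx; rewrite mem_rcons inE => /predU1P[xz'|//].
  by move: xz; rewrite /= xz' ltxx.
have above x : z < x -> all (< x) zs.
  by move=> zx; apply/allP => y /(allP zsz)/= yz; apply: (lt_trans yz).
have [[x0 [Ex0 zx0 gx0]]|nex] :=
    pselect (exists x, [/\ E x, z < x & e * g x < 0]).
  (* The sign of e g is wrong to the right of z. The new factor corrects it there, and its negative
     sign to the left of z is absorbed by replacing e with - e. *)
  exists (Q * ('X - z%:P)), (- e); split; rewrite ?oppr_eq0//.
  - rewrite (leq_trans (size_polyMleq _ _))// size_XsubC addn2/= size_rcons.
    by rewrite ltnS.
  - move=> x Ex; rewrite hornerM hornerXsubC.
    have [xz|zx|->] := ltrgtP x z; last by rewrite gz0 mulr0 mul0r.
      have := Qg x (conj Ex xz); rewrite mulrA 2!mulNr mulNr -mulrN opprB => h.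
      by rewrite mulr_ge0// subr_ge0 ltW.
    rewrite mulrA mulr_ge0 ?subr_ge0 ?(ltW zx)// mulr_ge0//; last first.
      by apply/ltW/Qpos/above.
    rewrite mulNr oppr_ge0 leNgt; apply/negP => egx.
    (* Values of opposite sign beyond z would force a zero of g to the right of the last one. *)
    have h : g x * g x0 < 0.
      have := nmulr_rlt0 (e * g x) gx0; rewrite egx mulrACA.
      by rewrite pmulr_rlt0 ?lt0r ?sqr_ge0 ?mulf_neq0// mulrC => ->.
    have nozero c : E c /\ z < c -> g c = 0 -> False.
      move=> [Ec zc] /(gE _ Ec); rewrite mem_rcons inE => /predU1P[cz|czs].
        by rewrite cz ltxx in zc.
      by have := allP zsz _ czs; rewrite /= ltNge (ltW zc).
    have [xx0|xx0|xx0] := ltrgtP x x0.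
    + have [c [Ec /andP[xc _]] gc] := ivt _ _ Ex Ex0 xx0 h.
      by apply: (nozero c) => //; split=> //; apply: lt_trans xc.
    + rewrite mulrC in h; have [c [Ec /andP[xc _]] gc] := ivt _ _ Ex0 Ex xx0 h.
      by apply: (nozero c) => //; split=> //; apply: lt_trans xc.
    + by move: h; rewrite xx0 ltNge sqr_ge0.
  - move=> x; rewrite all_rcons => /andP[/= zx xzs].
    by rewrite hornerM hornerXsubC mulr_gt0 ?subr_gt0// Qpos.
exists Q, e; split=> //.
- by rewrite size_rcons (leq_trans sQ).
- move=> x Ex; have [xz|zx|->] := ltrgtP x z; last by rewrite gz0 mulr0 mul0r.
    exact: Qg.
  rewrite mulr_ge0//; last by apply/ltW/Qpos/above.
  by rewrite leNgt; apply/negP => h; apply: nex; exists x.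
- by move=> x; rewrite all_rcons => /andP[/= zx xzs]; exact: Qpos.
Qed.

(** * Integrals of the Markov kernel *)

Lemma ae_ge0_Rintegral_le0 d (T : measurableType d) (R : realType)
    (m : {measure set T -> \bar R}) (D : set T) (g : T -> R) :
  measurable D -> m.-integrable D (EFin \o g) ->
  {ae m, forall w, D w -> 0 <= g w} -> \int[m]_(w in D) g w <= 0 ->
  {ae m, forall w, D w -> g w = 0}.
Proof.
move=> mD ig g0 gint.
have mg : measurable_fun D (EFin \o g) by apply: measurable_int ig.
have ig' := integrable_abse ig.
have intE : (\int[m]_(w in D) (EFin \o g) w = \int[m]_(w in D) `|(EFin \o g) w|)%E.
  apply: ae_eq_integral => //; first exact: measurableT_comp.
  by apply: filterS g0 => w g0 Dw; rewrite /= ger0_norm// g0.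
have : (\int[m]_(w in D) `|(EFin \o g) w| = 0)%E.
  apply/eqP; rewrite eq_le integral_ge0// andbT -intE.
  by rewrite -[leLHS]fineK ?integrable_fin_num// lee_fin.
move/(ae_eq_integral_abs m mD mg); apply: filterS => w h Dw.
by have [] := h Dw.
Qed.

Definition markov_kernel (R : realType) (x y : R) : R := (1 + x * y) / (x - y).

Lemma markov_kernel_sub (R : realType) (a b y : R) :
  y != a -> y != b ->
  markov_kernel a y - markov_kernel b y =
  (1 + y ^+ 2) * (b - a) / ((a - y) * (b - y)).
Proof.
move=> ya yb; rewrite /markov_kernel; field.
by rewrite !subr_eq0 ![_ == y]eq_sym ya yb.
Qed.

Lemma markov_kernel_le (R : realType) (a b y : R) :
  a <= b -> ~ (a <= y <= b) -> markov_kernel b y <= markov_kernel a y.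
Proof.
move=> ab yab; have ya : y != a.
  by apply/eqP => ya; apply: yab; rewrite ya lexx ab.
have yb : y != b by apply/eqP => yb; apply: yab; rewrite yb lexx ab.
rewrite -subr_ge0 markov_kernel_sub// divr_ge0//.
  by apply: mulr_ge0; [rewrite addr_ge0 ?sqr_ge0|rewrite subr_ge0].
have [ay|ay] := ltP y a.
  by rewrite mulr_ge0// subr_ge0 ltW// (lt_le_trans ay).
rewrite mulr_le0// subr_le0//; case: (lerP y b) => [yb'|/ltW//].
by case: yab; rewrite ay.
Qed.

(** Extends functions from [a, b] by constants to a neighbourhood, since continuity under the
    integral is applied on an open interval while domination holds only on [a, b]. *)
Definition clamp (R : realType) (a b x : R) : R := Num.max a (Num.min x b).

Lemma clamp_in (R : realType) (a b x : R) : a <= b -> a <= clamp a b x <= b.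
Proof.
by move=> ab; rewrite /clamp le_max lexx/= ge_max ab ge_min lexx orbT.
Qed.

Lemma clamp_id (R : realType) (a b x : R) : a <= x <= b -> clamp a b x = x.
Proof. by case/andP=> ax xb; rewrite /clamp (min_idPl xb) (max_idPr ax). Qed.

Lemma continuous_clamp (R : realType) (a b : R) : continuous (clamp a b).
Proof.
move=> x; have -> : clamp a b = (cst a \max (id \min cst b)) by exact/funext.
apply: continuous_max; first exact: cst_continuous.
by apply: continuous_min => //; exact: cst_continuous.
Qed.

Definition markov_fun d (T : measurableType d) (R : realType)
    (m : {measure set T -> \bar R}) (D : set T) (X : T -> R) (x : R) : R :=
  \int[m]_(w in D) markov_kernel x (X w).

(* Dominated convergence: the kernel is monotone in x away from its pole, hence
   on [a, b] it is dominated by its values at the endpoints. *)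
Lemma continuous_markov_fun d (T : measurableType d) (R : realType)
    (m : {measure set T -> \bar R}) (D : set T) (X : T -> R) (a b : R) :
  measurable D -> a <= b ->
  (forall x, a <= x <= b -> m.-integrable D (EFin \o (markov_kernel x \o X))) ->
  {ae m, forall w, D w -> ~ (a <= X w <= b)} ->
  forall x, a <= x <= b -> {for x, continuous (markov_fun m D X \o clamp a b)}.
Proof.
move=> mD ab ik nX x xab.
have aab : a <= a <= b by rewrite lexx.
have bab : a <= b <= b by rewrite ab lexx.
pose g w := `|markov_kernel a (X w)| + `|markov_kernel b (X w)|.
have xI : x \in `]a - 1, b + 1[%classic.
  by case/andP: xab => ax xb; rewrite inE/= in_itv/=; apply/andP; split; lra.
have /(_ _ _ g _ _ x xI) := @continuity_under_integral R d T m
  (fun x w => markov_kernel (clamp a b x) (X w)) D mD (a - 1) (b + 1).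
apply => //.
- by move=> y _; apply: ik; apply: clamp_in.
- apply: filterS nX => w h Dw y _; have {}h := h Dw.
  have cy : clamp a b y - X w != 0.
    rewrite subr_eq0; apply/eqP => e; apply: h; rewrite -e.
    exact: clamp_in.
  apply: cvgM.
    apply: cvgD; first exact: cvg_cst.
    by apply: cvgMr_tmp; exact: continuous_clamp.
  by apply: cvgV => //; apply: cvgB; [exact: continuous_clamp|exact: cvg_cst].
- have ia := integrable_norm (ik _ aab); have ib := integrable_norm (ik _ bab).
  by have := integrableD mD ia ib.
- move=> y _; apply: filterS nX => w h Dw; have {}h := h Dw.
  have /andP[cya cyb] := clamp_in y ab.
  have h1 := markov_kernel_le cya; have h2 := markov_kernel_le cyb.
  have {}h1 : markov_kernel (clamp a b y) (X w) <= markov_kernel a (X w).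
    by apply: h1 => /andP[p q]; apply: h; rewrite p (le_trans q).
  have {}h2 : markov_kernel b (X w) <= markov_kernel (clamp a b y) (X w).
    by apply: h2 => /andP[p q]; apply: h; rewrite q (le_trans _ p).
  rewrite /g; move: h1 h2; set u := markov_kernel _ _; set v := markov_kernel _ _.
  set z := markov_kernel _ _ => h1 h2.
  rewrite ler_norml; apply/andP; split.
    have := ler_norm (- v); have := normr_ge0 v; have := normr_ge0 z.
    have := ler_norm (- z); have := ler_norm z; have := ler_norm v.
    by rewrite !normrN; lra.
    have := ler_norm (- v); have := normr_ge0 v; have := normr_ge0 z.
    have := ler_norm (- z); have := ler_norm z; have := ler_norm v.
    by rewrite !normrN; lra.
Qed.

Lemma ivt_markov_fun d (T : measurableType d) (R : realType)
    (m : {measure set T -> \bar R}) (D : set T) (X : T -> R) (E : set R)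
    (A B : R -> R) :
  measurable D -> is_interval E ->
  (forall x, E x -> m.-integrable D (EFin \o (markov_kernel x \o X))) ->
  {ae m, forall w, D w -> ~ E (X w)} -> continuous A -> continuous B ->
  ivt_on E (fun x => A x + B x * markov_fun m D X x).
Proof.
move=> mD itvE ik nX cA cB a b Ea Eb ab gab.
have sub x : a <= x <= b -> E x.
  by move=> xab; apply: (itvE a b).
pose G x := A x + B x * (markov_fun m D X \o clamp a b) x.
have cont : {within `[a, b], continuous G}.
  apply: continuous_in_subspaceT => x; rewrite inE/= in_itv/= => xab.
  apply: cvgD; first exact: cA.
  apply: cvgM; first exact: cB.
  apply: continuous_markov_fun => //; first exact: ltW.
    by move=> y /sub; exact: ik.
  by apply: filterS nX => w h Dw /sub; exact: h.
have GE x : a <= x <= b -> G x = A x + B x * markov_fun m D X x.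
  by move=> xab; rewrite /G /= clamp_id.
have Ga := GE a; have Gb := GE b; rewrite lexx ltW//= in Ga.
rewrite lexx ltW//= in Gb.
rewrite -Ga// -Gb// in gab.
have ga0 : G a != 0 by apply: contraTneq gab => ->; rewrite mul0r ltxx.
have gb0 : G b != 0 by apply: contraTneq gab => ->; rewrite mulr0 ltxx.
have [|c cab Gc] := IVT (ltW ab) cont (v := 0).
  rewrite ge_min le_max; move: gab.
  have [p|p|p] := ltrgtP (G a) 0; last by rewrite p eqxx in ga0.
    by rewrite nmulr_rlt0// => /ltW ->; rewrite orbT.
  by rewrite pmulr_rlt0// => /ltW ->; rewrite orbT.
move: cab; rewrite in_itv/= => cab.
exists c; last by rewrite -GE.
split; first exact: sub.
case/andP: cab => ac cb; rewrite !lt_neqAle ac cb !andbT.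
apply/andP; split; apply/eqP => e.
  by move: ga0; rewrite e Gc eqxx.
by move: gb0; rewrite -e Gc eqxx.
Qed.

Lemma finite_roots (R : realType) (p : {poly R}) :
  p != 0 -> exists s : seq R, forall x, root p x -> x \in s.
Proof.
move=> p0; have [s us ps|s [_ _ sP]] :=
  @finite_sorted_enum R (fun x => root p x) (size p).
  by apply: max_poly_roots => //; apply/allP => x /ps.
by exists s => x /sP.
Qed.

(** A point outside an interval lies on one side of all x_i, so the factors have a common sign, and
    their number is even. *)
Lemma prod_sub_gt0 (R : realType) (E : set R) (M : nat) (x : 'I_M.*2 -> R) (y : R) :
  is_interval E -> (forall i, E (x i)) -> ~ E y -> 0 < \prod_i (y - x i).
Proof.
move=> itvE Ex Ey.
have yx i : y != x i by apply/eqP => e; apply: Ey; rewrite e.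
have [[i xiy]|nlt] := pselect (exists i, x i < y).
  apply: prodr_gt0 => j _; rewrite subr_gt0 lt_neqAle eq_sym yx/= leNgt.
  by apply/negP => yxj; apply: Ey; apply: (itvE (x i) (x j)) => //; rewrite !ltW.
under eq_bigr do rewrite -opprB.
rewrite prodrN cardT size_enum_ord -signr_odd odd_double expr0 mul1r.
apply: prodr_gt0 => j _; rewrite subr_gt0 lt_neqAle yx/= leNgt.
by apply/negP => h; apply: nlt; exists j.
Qed.

(** For fixed y, partial fractions of Q(X)(1 + yX), whose degree is still below the number of nodes,
    turn minus the sum of c_i Q(x_i) times the kernel into (1 + y^2) Q(y) / prod (y - x_i) >= 0. If
    its integral is nonpositive it vanishes almost everywhere, which would confine the measure to
    the roots of Q. *)
Lemma positive_functional_markov d (T : measurableType d) (R : realType)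
    (m : {measure set T -> \bar R}) (D : set T) (X : T -> R) (E : set R)
    (M : nat) (x : 'I_M.*2 -> R) :
  measurable D -> is_interval E ->
  (forall x, E x -> m.-integrable D (EFin \o (markov_kernel x \o X))) ->
  {ae m, forall w, D w -> ~ E (X w)} ->
  (forall s : seq R, ~ {ae m, forall w, D w -> X w \in s}) ->
  injective x -> (forall i, E (x i)) ->
  positive_functional x (fun i => markov_fun m D X (x i)).
Proof.
move=> mD itvE ik nX inf xinj Ex Q sQ Q0 fQ.
apply/eqP; rewrite -[Q == 0]negbK; apply/negP => nQ.
have [s sP] := finite_roots nQ; apply: (inf s).
pose c i := node_weight x i * Q.[x i].
pose G w := \sum_(i < M.*2) - c i * markov_kernel (x i) (X w).
have iG : m.-integrable D (EFin \o G).
  have -> : EFin \o G = (fun w => \sum_(i < M.*2)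
      (- c i)%:E * (EFin \o (markov_kernel (x i) \o X)) w)%E.
    by apply/funext => w; rewrite /G/= -sumEFin.
  by apply: integrable_sum => // i _; apply: integrableZl => //; exact: ik.
have GE w : ~ E (X w) ->
    G w = (1 + X w ^+ 2) * Q.[X w] / \prod_i (X w - x i).
  move=> EX; have Xx i : X w != x i by apply/eqP => e; apply: EX; rewrite e.
  have sQX : (size (Q * (1 + X w *: 'X))%R <= M.*2)%N.
    rewrite mulrC (leq_trans (@size_polyM_le R _ _ 1 (M.*2.-1) _ _))//.
    - rewrite (leq_trans (size_polyD _ _))// size_poly1 geq_max/=.
      by rewrite (leq_trans (size_scale_leq _ _))// size_polyX.
    - by move: sQ; case: (M.*2).
    - by move: sQ; case: (M.*2).
  have := partial_fractions xinj sQX Xx.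
  have hE z : (Q * (1 + X w *: 'X)).[z] = Q.[z] * (1 + X w * z).
    by rewrite !hornerE.
  rewrite hE -expr2 [X in _ = X / _]mulrC => <-.
  apply: eq_bigr => i _; rewrite hE /c /markov_kernel; field.
  by rewrite !subr_eq0 Xx eq_sym Xx.
have ae0 : {ae m, forall w, D w -> 0 <= G w}.
  apply: filterS nX => w h Dw; rewrite GE; last exact: h.
  rewrite divr_ge0//; last by apply/ltW/(prod_sub_gt0 itvE) => //; exact: h.
  by rewrite mulr_ge0// addr_ge0 ?sqr_ge0.
have intG : \int[m]_(w in D) G w <= 0.
  have -> : \int[m]_(w in D) G w = - \sum_(i < M.*2)
      node_weight x i * markov_fun m D X (x i) * Q.[x i].
    rewrite /Rintegral.
    have -> : (\int[m]_(w in D) (G w)%:E = \sum_(i < M.*2)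
        (- c i * markov_fun m D X (x i))%:E)%E.
      transitivity (\int[m]_(w in D) (\sum_(i < M.*2)
          (- c i)%:E * (EFin \o (markov_kernel (x i) \o X)) w))%E.
        by apply: eq_integral => w _; rewrite /G/= -sumEFin.
      rewrite integral_sum//=; last first.
        by move=> i; apply: integrableZl => //; exact: ik.
      apply: eq_bigr => i _; rewrite integralZl//; last exact: ik.
      by rewrite EFinM /markov_fun /Rintegral fineK// integrable_fin_num//; exact: ik.
    rewrite sumEFin/= -sumrN; apply: eq_bigr => i _; rewrite /c; ring.
  by rewrite oppr_le0.
have := ae_ge0_Rintegral_le0 mD iG ae0 intG.
apply: filterS2 nX => w nE G0 Dw; apply: sP; apply/rootP.
have /eqP := G0 Dw; rewrite GE; last exact: nE.
rewrite !mulf_eq0 invr_eq0 (gt_eqF (prod_sub_gt0 itvE Ex (nE Dw))) orbF.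
by rewrite gt_eqF ?ltr_pwDl ?sqr_ge0//= => /eqP.
Qed.

(** * Powers of (1 + x^2)^(-1/2) and moments with these weights *)

Definition inv_japanese (R : realType) (x : R) : R := (Num.sqrt (1 + x ^+ 2))^-1.

Lemma inv_japanese_gt0 (R : realType) (x : R) : 0 < inv_japanese x.
Proof. by rewrite invr_gt0 sqrtr_gt0 ltr_pwDl ?sqr_ge0. Qed.

Lemma sqr_inv_japanese (R : realType) (x : R) :
  inv_japanese x ^+ 2 = (1 + x ^+ 2)^-1.
Proof. by rewrite exprVn sqr_sqrtr// addr_ge0 ?sqr_ge0. Qed.

(** Hence a polynomial of degree at most e times the e-th power of [inv_japanese] is bounded, and
    the integrability of a density h is enough for its weighted moments to exist. *)
Lemma normr_mul_inv_japanese (R : realType) (x : R) (i e : nat) :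
  (i <= e)%N -> `|x ^+ i * inv_japanese x ^+ e| <= 1.
Proof.
move=> ie; have t0 := inv_japanese_gt0 x.
have w0 : 0 < 1 + x ^+ 2 by rewrite ltr_pwDl ?sqr_ge0.
have t1 : inv_japanese x <= 1.
  rewrite -(@ler_pXn2r _ 2) ?nnegrE ?ler01 ?(ltW t0)// expr1n sqr_inv_japanese.
  by rewrite invf_le1// lerDl sqr_ge0.
have xt : `|x| * inv_japanese x <= 1.
  rewrite -(@ler_pXn2r _ 2) ?nnegrE ?ler01 ?(mulr_ge0 _ (ltW t0))// expr1n exprMn.
  by rewrite sqr_inv_japanese real_normK ?num_real// ler_pdivrMr// mul1r lerDr.
rewrite normrM !normrX (gtr0_norm t0) -(subnK ie) exprD mulrCA -exprMn.
have xt0 : 0 <= `|x| * inv_japanese x by rewrite mulr_ge0// ltW.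
by rewrite mulr_ile1 ?exprn_ile1 ?exprn_ge0 ?(ltW t0).
Qed.

Lemma continuous_inv_japanese (R : realType) : continuous (@inv_japanese R).
Proof.
move=> x; apply: cvgV.
  by rewrite gt_eqF// sqrtr_gt0 ltr_pwDl ?sqr_ge0.
have : {for x, continuous (@Num.sqrt R \o (fun x => 1 + x ^+ 2))}; last by [].
apply: continuous_comp; last exact: sqrt_continuous.
by apply: cvgD; [exact: cvg_cst|exact: exprn_continuous].
Qed.

Lemma continuous_weighted_poly (R : realType) (p : {poly R}) (e : nat) :
  continuous (fun x => p.[x] * inv_japanese x ^+ e).
Proof.
move=> x; apply: cvgM; first exact: continuous_horner.
have : {for x, continuous ((fun t => t ^+ e) \o @inv_japanese R)}; last by [].
by apply: continuous_comp; [exact: continuous_inv_japanese|exact: exprn_continuous].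
Qed.

Definition weighted_moment d (T : measurableType d) (R : realType)
    (m : {measure set T -> \bar R}) (D : set T) (X h : T -> R) (e i : nat) : R :=
  \int[m]_(w in D) (X w ^+ i * inv_japanese (X w) ^+ e * h w).

Lemma integrable_weighted_poly d (T : measurableType d) (R : realType)
    (m : {measure set T -> \bar R}) (D : set T) (X h : T -> R) (e : nat)
    (p : {poly R}) :
  measurable D -> measurable_fun D X -> m.-integrable D (EFin \o h) ->
  (size p <= e.+1)%N ->
  m.-integrable D (EFin \o (fun w => p.[X w] * inv_japanese (X w) ^+ e * h w)).
Proof.
move=> mD mX ih sp.
have -> : EFin \o (fun w => p.[X w] * inv_japanese (X w) ^+ e * h w) =
    ((EFin \o (fun w => p.[X w] * inv_japanese (X w) ^+ e)%R) \* (EFin \o h))%E.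
  by apply/funext => w /=; rewrite EFinM.
apply: integrableMr => //.
  apply: (@measurableT_comp _ _ _ _ _ _
    (fun x => p.[x] * inv_japanese x ^+ e) _ X) => //.
  by apply: continuous_measurable_fun; exact: continuous_weighted_poly.
pose B := \sum_(i < size p) `|p`_i|.
suff HB r : B < r -> forall w, D w -> `|p.[X w] * inv_japanese (X w) ^+ e| <= r.
  exact: (ex_intro _ B (conj (num_real B) HB)).
move=> pr w _; apply: (le_trans _ (ltW pr)).
rewrite horner_coef mulr_suml (le_trans (ler_norm_sum _ _ _))// ler_sum// => i _.
rewrite -mulrA normrM ler_piMr// normr_mul_inv_japanese//.
by have := ltn_ord i; lia.
Qed.

Lemma weighted_moment_poly d (T : measurableType d) (R : realType)
    (m : {measure set T -> \bar R}) (D : set T) (X h : T -> R) (e : nat)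
    (p : {poly R}) :
  measurable D -> measurable_fun D X -> m.-integrable D (EFin \o h) ->
  (size p <= e.+1)%N ->
  \int[m]_(w in D) (p.[X w] * inv_japanese (X w) ^+ e * h w) =
  \sum_(i < e.+1) p`_i * weighted_moment m D X h e i.
Proof.
move=> mD mX ih sp.
have ii i : (i < e.+1)%N -> m.-integrable D (EFin \o
    (fun w => X w ^+ i * inv_japanese (X w) ^+ e * h w)).
  move=> ie; have := @integrable_weighted_poly d T R m D X h e 'X^i mD mX ih.
  rewrite size_polyXn => /(_ ie); congr (_.-integrable _ _); apply/funext => w /=.
  by rewrite hornerXn.
rewrite /Rintegral.
transitivity (fine (\int[m]_(w in D) (\sum_(i < e.+1) (p`_i)%:E *
    (EFin \o (fun w => X w ^+ i * inv_japanese (X w) ^+ e * h w)%R) w)))%E.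
  congr fine; apply: eq_integral => w _.
  rewrite (horner_coef_wide _ sp) !mulr_suml -sumEFin; apply: eq_bigr => i _.
  by rewrite /= -!EFinM -!mulrA.
rewrite integral_sum//=; last first.
  by move=> i; apply: integrableZl => //; exact: ii.
under eq_bigr => i _.
  rewrite integralZl//; last exact: ii.
  rewrite -[X in (_ * X)%E]fineK; last by apply: integrable_fin_num => //; exact: ii.
  rewrite -EFinM.
  over.
by rewrite sumEFin.
Qed.

(** * The problem on the real line *)

Lemma markov_fun_sign d (T : measurableType d) (R : realType)
    (m : {measure set T -> \bar R}) (D : set T) (X : T -> R) (E : set R) :
  measurable D -> is_interval E ->
  (forall x, E x -> m.-integrable D (EFin \o (markov_kernel x \o X))) ->
  {ae m, forall w, D w -> ~ E (X w)} ->
  (forall x, E x -> markov_fun m D X x != 0) ->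
  exists e, forall x, E x -> 0 < markov_fun m D X x * e.
Proof.
move=> mD itvE ik nX f0.
have [[x0 Ex0]|E0] := pselect (exists x, E x); last first.
  by exists 1 => x Ex; exfalso; apply: E0; exists x.
exists (markov_fun m D X x0) => x Ex.
rewrite lt_neqAle eq_sym mulf_neq0 ?f0//= leNgt; apply/negP.
have ivt : ivt_on E (fun y => cst 0 y + cst 1 y * markov_fun m D X y).
  by apply: ivt_markov_fun => //; exact: cst_continuous.
have fE y : cst 0 y + cst 1 y * markov_fun m D X y = markov_fun m D X y.
  by rewrite /= add0r mul1r.
have {}ivt a b : E a -> E b -> a < b ->
    ~ markov_fun m D X a * markov_fun m D X b < 0.
  move=> Ea Eb ab h; have := ivt a b Ea Eb ab; rewrite !fE => /(_ h)[c [Ec _]].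
  by rewrite fE; apply/eqP/f0.
have [xx0|xx0|->] := ltrgtP x x0; first exact: ivt.
- by rewrite mulrC; exact: ivt.
- by apply/negP; rewrite -leNgt -expr2 sqr_ge0.
Qed.

Lemma nikishin_zeros d (T : measurableType d) (R : realType)
    (m : {measure set T -> \bar R}) (D : set T) (X : T -> R) (E : set R)
    (M n1 n2 e1 e2 : nat) (a b : {poly R}) (s : seq R) :
  measurable D -> is_interval E ->
  (forall x, E x -> m.-integrable D (EFin \o (markov_kernel x \o X))) ->
  {ae m, forall w, D w -> ~ E (X w)} ->
  (forall s : seq R, ~ {ae m, forall w, D w -> X w \in s}) ->
  (forall x, E x -> markov_fun m D X x != 0) ->
  (n1 + n2 = M.*2)%N -> (e1 + n2 = e2 + n1)%N ->
  (size a <= n1)%N -> (size b <= n2)%N ->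
  uniq s -> (M.*2 <= size s)%N ->
  (forall x, x \in s -> E x /\
    a.[x] * inv_japanese x ^+ e1 +
    b.[x] * inv_japanese x ^+ e2 * markov_fun m D X x = 0) ->
  a = 0 /\ b = 0.
Proof.
move=> mD itvE ik nX inf f0 nM e12 sa sb us ss sE.
pose x (i : 'I_M.*2) := s`_i.
have xs i : x i \in s by rewrite mem_nth// (leq_trans (ltn_ord i)).
have xinj : injective x.
  move=> i j /eqP; rewrite nth_uniq ?(leq_trans (ltn_ord _))// => /eqP.
  exact: val_inj.
have Ex i : E (x i) by have [] := sE _ (xs i).
have posf := positive_functional_markov mD itvE ik nX inf xinj Ex.
have w0 y : 1 + y ^+ 2 != 0 :> R by rewrite gt_eqF// ltr_pwDl ?sqr_ge0.
have t0 (y : R) e : inv_japanese y ^+ e != 0.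
  by rewrite expf_neq0// gt_eqF// inv_japanese_gt0.
have td (y : R) d' : inv_japanese y ^+ d'.*2 = (1 + y ^+ 2) ^- d'.
  by rewrite -mul2n exprM sqr_inv_japanese exprVn.
have [n21|n12] := leqP n2 n1.
  (* n1 - n2 is even because n1 + n2 is, and e1 - e2 = n1 - n2; the quotient of the two weights is
     thus (1 + x^2)^(-k). *)
  pose k := (n1 - n2)./2.
  have kE : k.*2 = (n1 - n2)%N.
    by have := odd_double_half (n1 - n2); rewrite -/k; have := odd_double M; lia.
  have n1E : n1 = (n2 + k.*2)%N by lia.
  have e1E : e1 = (k.*2 + e2)%N by lia.
  apply: (nikishin_system_ge xinj (esym nM) posf n1E sa sb) => i.
  have [_] := sE _ (xs i); rewrite e1E exprD td => /eqP h.
  apply/eqP; rewrite -(mulIr_eq0 _ (mulIf (t0 (x i) e2))).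
  rewrite -(mulIr_eq0 _ (mulIf (invr_neq0 (expf_neq0 k (w0 (x i)))))).
  rewrite -[X in _ == X](eqP h); apply/eqP; field.
  exact: expf_neq0.
have [e fe] := markov_fun_sign mD itvE ik nX f0.
pose k := (n2 - n1)./2.
have kE : k.*2 = (n2 - n1)%N.
  by have := odd_double_half (n2 - n1); rewrite -/k; have := odd_double M; lia.
have n1E : M = (n1 + k)%N by lia.
have n2E : n2 = (M + k)%N by lia.
have e2E : e2 = (k.*2 + e1)%N by lia.
apply: (nikishin_system_lt xinj posf n1E n2E (fun i => fe _ (Ex i)) sa sb) => i.
have [_] := sE _ (xs i); rewrite e2E exprD td => /eqP h.
apply/eqP; rewrite -(mulIr_eq0 _ (mulIf (t0 (x i) e1))).
rewrite -(mulIr_eq0 _ (mulIf (invr_neq0 (expf_neq0 k (w0 (x i)))))).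
rewrite -[X in _ == X](eqP h); apply/eqP; field.
exact: expf_neq0.
Qed.

(** The sum stops at e because x^i (1 + x^2)^(-e/2) is bounded only for i <= e. The ring is
    arbitrary so that real moments can be paired with complex polynomials. *)
Definition moment_form (A : comNzRingType) (mom : nat -> A) (e : nat)
    (p : {poly A}) : A := \sum_(i < e.+1) p`_i * mom i.

Lemma moment_formE (A : comNzRingType) (mom : nat -> A) (e : nat)
    (p q : {poly A}) :
  moment_form mom e (p * q) =
  \sum_(k < size p) p`_k * moment_form mom e ('X^k * q).
Proof.
rewrite -{1}[p]coefK poly_def mulr_suml /moment_form.
under eq_bigr do rewrite coef_sum mulr_suml.
rewrite exchange_big/=; apply: eq_bigr => k _.
by rewrite mulr_sumr; apply: eq_bigr => i _; rewrite -scalerAl coefZ mulrA.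
Qed.

(* The transpose of the orthogonality system: a function a t^e1 + b t^e2 f with fewer
   than M.*2 zeros on E is matched in sign by a polynomial of degree < M.*2. *)
Lemma nikishin_line d (T : measurableType d) (R : realType)
    (m1 m2 : {measure set T -> \bar R}) (D : set T) (X h : T -> R) (E : set R)
    (M n1 n2 e1 e2 : nat) (a b : {poly R}) :
  measurable D -> measurable_fun D X -> is_interval E ->
  {ae m1, forall w, D w -> E (X w)} ->
  (forall s : seq R, ~ {ae m1, forall w, D w -> X w \in s}) ->
  (forall x, E x -> m2.-integrable D (EFin \o (markov_kernel x \o X))) ->
  {ae m2, forall w, D w -> ~ E (X w)} ->
  (forall s : seq R, ~ {ae m2, forall w, D w -> X w \in s}) ->
  (forall x, E x -> markov_fun m2 D X x != 0) ->
  m1.-integrable D (EFin \o cst 1) -> m1.-integrable D (EFin \o h) ->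
  {ae m1, forall w, D w -> h w = markov_fun m2 D X (X w)} ->
  (n1 + n2 = M.*2)%N -> (e1.+2 = M.*2 + n1)%N -> (e2.+2 = M.*2 + n2)%N ->
  (size a <= n1)%N -> (size b <= n2)%N ->
  (forall k, (k < M.*2)%N ->
    moment_form (weighted_moment m1 D X (cst 1) e1) e1 ('X^k * a) +
    moment_form (weighted_moment m1 D X h e2) e2 ('X^k * b) = 0) ->
  a = 0 /\ b = 0.
Proof.
move=> mD mX itvE XE inf1 ik nX inf2 f0 i1 ih hE nM e1E e2E sa sb mom0.
apply: contrapT => ab0.
pose f := markov_fun m2 D X.
pose A x := a.[x] * inv_japanese x ^+ e1.
pose B x := b.[x] * inv_japanese x ^+ e2.
pose g x := A x + B x * f x.
have ivt : ivt_on E g.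
  by apply: ivt_markov_fun => //; exact: continuous_weighted_poly.
have [s us sz|zs [zs_sorted zs_size zsP]] :=
    @finite_sorted_enum R (fun x => E x /\ g x = 0) M.*2.
  rewrite ltnNge; apply/negP => Ms; apply: ab0.
  by apply: (@nikishin_zeros d T R m2 D X E M n1 n2 e1 e2 a b s) => //; lia.
have [z /zsP[]//|x Ex gx|Q [e [sQ e0 Qg Qpos]]] := sign_polynomial ivt zs_sorted.
  by apply/zsP.
have [s sP] : exists s : seq R, forall x, root Q x -> x \in s.
  apply: finite_roots; apply/eqP => Q0.
  (* A point to the right of all zeros, where Q is positive; so Q is not the zero polynomial. *)
  have /Qpos : all (< (1 + \sum_(z <- zs) `|z|)) zs.
    apply/allP => y yzs /=.
    rewrite (le_lt_trans (ler_norm y))// (big_rem y yzs)/= addrCA ltrDl.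
    by rewrite ltr_pwDl// sumr_ge0.
  by rewrite Q0 horner0 ltxx.
(* The value of e1 is exactly what this needs: deg Q <= 2M - 1 and deg a <= n1 - 1 add up to at most
   e1. *)
have sQa : (size (Q * a)%R <= e1.+1)%N.
  by rewrite (leq_trans (size_polyMleq _ _))//; lia.
have sQb : (size (Q * b)%R <= e2.+1)%N.
  by rewrite (leq_trans (size_polyMleq _ _))//; lia.
pose G w := e * ((Q * a).[X w] * inv_japanese (X w) ^+ e1 * cst 1 w +
  (Q * b).[X w] * inv_japanese (X w) ^+ e2 * h w).
have iGa := integrable_weighted_poly mD mX i1 sQa.
have iGb := integrable_weighted_poly mD mX ih sQb.
have iG : m1.-integrable D (EFin \o G).
  by have := integrableZl mD e (integrableD mD iGa iGb).
have GE w : D w -> h w = f (X w) -> G w = e * g (X w) * Q.[X w].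
  by move=> Dw hw; rewrite /G hw /g /A /B !hornerM /=; ring.
have Gge0 : {ae m1, forall w, D w -> 0 <= G w}.
  by apply: filterS2 XE hE => w XE hE Dw; rewrite GE ?hE//; exact/Qg/XE.
have intG : \int[m1]_(w in D) G w <= 0.
  rewrite /G RintegralZl//; last by have := integrableD mD iGa iGb.
  rewrite RintegralD// !weighted_moment_poly//.
  rewrite -!/(moment_form _ _ _) !moment_formE -big_split/=.
  rewrite big1 ?mulr0// => k _; rewrite -mulrDr mom0 ?mulr0//.
  by rewrite (leq_trans (ltn_ord k))// (leq_trans sQ).
have := ae_ge0_Rintegral_le0 mD iG Gge0 intG.
(* G is nonnegative with nonpositive integral, so the first measure would live on the finitely many
   zeros of g and Q. *)
move=> G0; apply: (inf1 (zs ++ s)); apply: filterS2 (filterI XE hE) G0 => w.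
move=> [XE' hE'] G0 Dw; rewrite mem_cat; have /eqP := G0 Dw.
rewrite GE ?hE'// !mulf_eq0 (negPf e0)/= => /orP[/eqP gw|/sP -> ]; last first.
  by rewrite orbT.
by apply/orP; left; apply/zsP; split=> //; exact: XE'.
Qed.

(** * The Cayley transform of the circle *)

Local Open Scope complex_scope.

Lemma cisD (R : realType) (s t : R) : cis (s + t) = cis s * cis t.
Proof.
rewrite /cis cosD sinD; simpc; congr (_ +i* _); ring.
Qed.

Lemma cis0 (R : realType) : cis (0 : R) = 1.
Proof. by rewrite /cis cos0 sin0. Qed.

Lemma norm_cis (R : realType) (t : R) : `|cis t| = 1.
Proof. by rewrite /cis; simpc; rewrite cos2Dsin2 sqrtr1. Qed.

Lemma cis_neq0 (R : realType) (t : R) : cis t != 0.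
Proof. by rewrite -normr_gt0 norm_cis ltr01. Qed.

Lemma cisN (R : realType) (t : R) : cis (- t) = (cis t)^-1.
Proof.
apply: (mulIf (cis_neq0 t)); rewrite mulVf ?cis_neq0//.
by rewrite -cisD addNr cis0.
Qed.

Lemma cisDpi (R : realType) (t : R) (n : int) : cis (t + n%:~R * (2 * pi)) = cis t.
Proof.
have cis1 (u : R) : cis (u + 2 * pi) = cis u.
  by rewrite /cis mulr2n mulrDl mul1r -mulr2n cosD2pi sinD2pi.
have nat (k : nat) (u : R) : cis (u + k%:R * (2 * pi)) = cis u.
  elim: k u => [|k IH] u; first by rewrite mul0r addr0.
  by rewrite -natr1 mulrDl mul1r addrA cis1.
case: n => k; first exact: nat.
rewrite NegzE mulrNz -[in RHS](@subrK _ (k.+1%:R * (2 * pi)) t) nat.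
by rewrite mulNr -pmulrn.
Qed.

Lemma cis_inj (R : realType) (t0 s t : R) :
  t0 <= s < t0 + 2 * pi -> t0 <= t < t0 + 2 * pi -> cis s = cis t -> s = t.
Proof.
wlog st : s t / s <= t.
  move=> H ss tt e; have [h|h] := leP s t; first exact: H.
  by apply/esym/H => //; exact: ltW.
move=> /andP[s0 s1] /andP[u0 u1] e.
have c1 : cis (t - s) = 1 by rewrite cisD cisN e mulfV// cis_neq0.
have ts : 0 <= t - s < 2 * pi by apply/andP; split; lra.
have : cos (t - s) = 1 by have [] := c1.
set u := t - s in ts *; rewrite (_ : u = u / 2 + u / 2); last by field.
rewrite cosD -!expr2 cos2sin2 => h.
have {}h : sin (u / 2) = 0.
  by apply/eqP; rewrite -sqrf_eq0; apply/eqP; lra.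
have [u0'|u0'] := eqVneq u 0; first by rewrite /u in u0'; lra.
have : 0 < sin (u / 2).
  by apply: sin_gt0_pi; case/andP: ts => a b; move: u0'; rewrite neq_lt => /orP[]; lra.
by rewrite h ltxx.
Qed.

(** The Moebius map of [cayleyE], parametrised by its angle: this angle lies in the window of the
    branch, so the square root is read off by halving it. The angle decreases in x. *)
Definition cayley (R : realType) (t0 x : R) : R[i] :=
  cis (t0 + pi - 2 * atan x).

(** With c = cis t0, the quotient (z + c)/(z - c) is purely imaginary on the circle and equals - i x
    at z = [cayley t0 x]. A formula on the whole plane gives measurability together with that of the
    kernel. *)
Definition cayley_inv (R : realType) (t0 : R) (z : R[i]) : R :=
  - complex.Im (cara_kernel (cis t0) z).

Lemma sin_atan (R : realType) (x : R) : sin (atan x) = x * inv_japanese x.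
Proof.
have c0 : cos (atan x) != 0.
  by rewrite cos_atan invr_eq0 gt_eqF// sqrtr_gt0 ltr_pwDl ?sqr_ge0.
have /(congr1 ( *%R^~ (cos (atan x)))) := atanK x.
by rewrite /tan divfK// => ->; rewrite cos_atan.
Qed.

Lemma cis_half_cayley (R : realType) (t0 x : R) :
  cis ((t0 + pi - 2 * atan x) / 2) =
  cis (t0 / 2) * ((x +i* 1) * (inv_japanese x)%:C).
Proof.
have -> : (t0 + pi - 2 * atan x) / 2 = t0 / 2 + (- atan x + pi / 2) by field.
rewrite cisD; congr (_ * _); rewrite /cis cosDpihalf sinDpihalf sinN cosN opprK.
by simpc; rewrite sin_atan cos_atan.
Qed.

Lemma norm_cayley (R : realType) (t0 x : R) : `|cayley t0 x| = 1.
Proof. exact: norm_cis. Qed.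

Lemma subi_neq0 (R : realType) (x : R) : x -i* 1 != 0.
Proof. by rewrite eq_complex /= oppr_eq0 oner_eq0 andbF. Qed.

Lemma cayleyE (R : realType) (t0 x : R) :
  cayley t0 x = cis t0 * ((x +i* 1) / (x -i* 1)).
Proof.
rewrite /cayley (_ : t0 + pi - 2 * atan x =
  (t0 + pi - 2 * atan x) / 2 + (t0 + pi - 2 * atan x) / 2); last by field.
rewrite cisD cis_half_cayley mulrACA -cisD -splitr; congr (_ * _).
apply: (mulIf (subi_neq0 x)); rewrite divfK ?subi_neq0//.
have t2 := sqr_inv_japanese x; have w0 : 1 + x ^+ 2 != 0.
  by rewrite gt_eqF// ltr_pwDl ?sqr_ge0.
set u := x +i* 1; set v := x -i* 1; set t := (inv_japanese x)%:C.
have h : u * v * (t * t) = 1.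
  rewrite /t -rmorphM -expr2 t2 /u /v; simpc; congr (_ +i* _); last by field.
  by field.
by rewrite -[RHS]mulr1 -h; ring.
Qed.

Lemma cara_kernel_cayley (R : realType) (t0 x y : R) :
  cara_kernel (cayley t0 x) (cayley t0 y) = 0 -i* markov_kernel x y.
Proof.
(* On the diagonal both sides are the default value 0 of a division by zero. *)
have [->|xy] := eqVneq x y.
  by rewrite /cara_kernel /markov_kernel !subrr !invr0 !mulr0 oppr0.
rewrite /cara_kernel !cayleyE.
have h1 := subi_neq0 x; have h2 := subi_neq0 y; have h0 := cis_neq0 t0.
have xy' : x - y != 0 by rewrite subr_eq0.
have d : (y +i* 1) * (x -i* 1) - (x +i* 1) * (y -i* 1) = 0 +i* (2 * (x - y)).
  by simpc; congr (_ +i* _); ring.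
have s : (y +i* 1) * (x -i* 1) + (x +i* 1) * (y -i* 1) = (2 * (1 + x * y))%:C.
  by simpc; congr (_ +i* _); ring.
have d0 : 0 +i* (2 * (x - y)) != 0.
  by rewrite eq_complex /= mulf_eq0 (negPf xy') orbF (eqr_nat _ 2 0) andbF.
transitivity ((2 * (1 + x * y))%:C / (0 +i* (2 * (x - y)))).
  rewrite -s -d; field; rewrite -d in d0.
  rewrite h1 h2 d0/= (_ : _ + _ = cis t0 *
    ((y +i* 1) * (x -i* 1) - (x +i* 1) * (y -i* 1))); last by ring.
  by rewrite mulf_neq0.
apply: (mulIf d0); rewrite divfK//; simpc; congr (_ +i* _).
by rewrite /markov_kernel; field.
Qed.

Lemma cayley_neq (R : realType) (t0 x : R) : cayley t0 x != cis t0.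
Proof.
rewrite cayleyE -subr_eq0 -{2}[cis t0]mulr1 -mulrBr mulf_neq0 ?cis_neq0//.
apply/eqP => /(congr1 ( *%R^~ (x -i* 1))); rewrite mulrBl divfK ?subi_neq0//.
rewrite mul0r mul1r; simpc => /eqP; rewrite eq_complex /= andbC.
by rewrite (eqr_nat _ 2 0).
Qed.

Lemma cayleyK (R : realType) (t0 : R) : cancel (cayley t0) (cayley_inv t0).
Proof.
move=> x; rewrite /cayley_inv /cara_kernel cayleyE.
have h1 := subi_neq0 x; have h0 := cis_neq0 t0.
have -> : (cis t0 * ((x +i* 1) / (x -i* 1)) + cis t0) /
    (cis t0 * ((x +i* 1) / (x -i* 1)) - cis t0) = 0 -i* x.
  have n1 : (x +i* 1) - (x -i* 1) = 0 +i* 2 by simpc; congr (_ +i* _).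
  have n2 : (x +i* 1) + (x -i* 1) = (2 * x)%:C by simpc; congr (_ +i* _); ring.
  have n10 : 0 +i* 2 != 0 :> R[i] by rewrite eq_complex /= (eqr_nat _ 2 0) andbF.
  transitivity ((2 * x)%:C / (0 +i* 2)).
    rewrite -n1 -n2; field; rewrite -n1 in n10.
    rewrite h1 n10/= (_ : cis t0 * _ + _ = cis t0 * ((x +i* 1) - (x -i* 1))); last by ring.
    by rewrite mulf_neq0.
  by apply: (mulIf n10); rewrite divfK//; simpc; congr (_ +i* _); ring.
by rewrite /= opprK.
Qed.

Lemma sqr_norm_circle (R : realType) (a b : R) :
  circle R (a +i* b) -> a ^+ 2 + b ^+ 2 = 1.
Proof.
rewrite /circle/=; simpc => -[/(congr1 (fun x => x ^+ 2))].
by rewrite sqr_sqrtr ?addr_ge0 ?sqr_ge0// expr1n.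
Qed.

Lemma cayley_invE (R : realType) (t0 : R) (z : R[i]) :
  cayley_inv t0 z =
  2 * (complex.Re (cis t0) * complex.Im z - complex.Im (cis t0) * complex.Re z) /
  ((complex.Re z - complex.Re (cis t0)) ^+ 2 +
   (complex.Im z - complex.Im (cis t0)) ^+ 2).
Proof.
rewrite /cayley_inv /cara_kernel; case: z => a b; case: (cis t0) => c d /=.
ring.
Qed.

Lemma cayley_invK (R : realType) (t0 : R) (z : R[i]) :
  circle R z -> z != cis t0 -> cayley t0 (cayley_inv t0 z) = z.
Proof.
move=> zc ze; set x := cayley_inv t0 z.
(* The real part of (z + c)/(z - c) is proportional to |z|^2 - |c|^2, which vanishes on the
   circle. *)
have k : cara_kernel (cis t0) z = 0 -i* x.
  rewrite /x /cayley_inv opprK; apply/eqP; rewrite eq_complex /= eqxx andbT.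
  have ec : circle R (cis t0) by exact: norm_cis.
  move: zc ec; rewrite /cara_kernel; case: z {ze x} => a b; case: (cis t0) => c d.
  move=> /sqr_norm_circle ab /sqr_norm_circle cd /=.
  rewrite mulrN opprK !mulrA -mulrDl mulf_eq0; apply/orP; left.
  apply/eqP; transitivity (a ^+ 2 + b ^+ 2 - (c ^+ 2 + d ^+ 2)); first by ring.
  by rewrite ab cd subrr.
have ze0 : z - cis t0 != 0 by rewrite subr_eq0.
move: k; rewrite /cara_kernel => /(congr1 ( *%R^~ (z - cis t0))).
rewrite divfK// => k.
rewrite cayleyE; apply: (mulIf (subi_neq0 x)); rewrite -mulrA divfK ?subi_neq0//.
have i0 : 'i != 0 :> R[i] by rewrite eq_complex /= oner_eq0 andbF.
have xE : x -i* 1 = - 'i * (1 + - (0 -i* x)).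
  by simpc; congr (_ +i* _).
have xE' : x +i* 1 = 'i * (1 + (0 -i* x)).
  by simpc; congr (_ +i* _).
rewrite xE xE' mulrCA [RHS]mulrCA mulNr -mulrN; congr (_ * _).
rewrite mulrDr mulr1 mulrDr mulr1.
move: k; set q := 0 -i* x; rewrite mulrBr mulrN opprD opprK ![_ * q]mulrC => k.
apply/eqP; rewrite -subr_eq0 opprD !opprK -addrA.
have : z + cis t0 - (q * z - q * cis t0) = 0 by rewrite k subrr.
by move=> h; rewrite -[X in _ == X]h; apply/eqP; ring.
Qed.

Lemma cayley_angle (R : realType) (t0 t : R) :
  t0 < t < t0 + 2 * pi -> t0 + pi - 2 * atan (tan ((t0 + pi - t) / 2)) = t.
Proof.
move=> /andP[h1 h2]; rewrite tanK; first by field.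
by rewrite in_itv/=; apply/andP; split; lra.
Qed.

Lemma cayley_angle_bounds (R : realType) (t0 x : R) :
  t0 <= t0 + pi - 2 * atan x < t0 + 2 * pi.
Proof. by have := atan_ltpi2 x; have := atan_gtNpi2 x; lra. Qed.

Lemma le_atanE (R : realType) (x y : R) : (atan x <= atan y) = (x <= y).
Proof.
have [h|h] := leP x y; first exact: le_atan.
by apply/negbTE; rewrite -ltNge lt_atan.
Qed.

(** A multiple of 2 pi brings the lower angle into [t0, t0 + 2 pi). As the arc avoids the cut, its
    whole angle interval then lies in the open window, where the Cayley map is a decreasing
    bijection; this exchanges the endpoints. *)
Lemma arc_cayley (R : realType) (t0 : R) (G : circle_arc R) :
  ~ arc_set G (cis t0) -> exists p q : R,
    [/\ p < q, arc_set G = [set cayley t0 x | x in `[p, q]]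
      & arc_ends G = [set cayley t0 p; cayley t0 q]].
Proof.
case: G => lo hi; rewrite /arc_set /arc_ends/= => /andP[len0 len1] ncut.
have pi0 := pi_gt0 R.
pose n := Num.floor ((lo - t0) / (2 * pi)).
have : n%:~R <= (lo - t0) / (2 * pi) < (n + 1)%:~R by exact: floor_itv.
rewrite ler_pdivlMr ?ltr_pdivrMr ?mulr_gt0// intrD.
set c : R := n%:~R * (2 * pi); rewrite mulrDl mul1r -/c => /andP[n1 n2].
have cisc t : cis (t - c) = cis t by rewrite -[in RHS](subrK c t) cisDpi.
have lo1 : t0 < lo - c.
  rewrite lt_neqAle; apply/andP; split; last lra.
  apply/eqP => e; apply: ncut; exists lo; last by rewrite e cisc.
  by rewrite /= in_itv/= lexx; lra.
have hi1 : hi - c < t0 + 2 * pi.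
  rewrite ltNge; apply/negP => h; apply: ncut; exists (t0 + c + 2 * pi).
    by rewrite /= in_itv/=; apply/andP; split; lra.
  by rewrite addrAC /c cisDpi; have := cisDpi t0 1; rewrite mul1r.
pose x t : R := tan ((t0 + pi - t) / 2).
have xE t : t0 < t < t0 + 2 * pi -> 2 * atan (x t) = t0 + pi - t.
  by move=> /cayley_angle h; rewrite -[in RHS]h /x; ring.
have chi := xE (hi - c); have clo := xE (lo - c).
have {}chi : 2 * atan (x (hi - c)) = t0 + pi - (hi - c) by apply: chi; lra.
have {}clo : 2 * atan (x (lo - c)) = t0 + pi - (lo - c) by apply: clo; lra.
have cx t : t0 < t - c < t0 + 2 * pi -> cayley t0 (x (t - c)) = cis t.
  by move=> h; rewrite /cayley /x cayley_angle.
exists (x (hi - c)), (x (lo - c)); split.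
- by rewrite ltNge -le_atanE -ltNge; lra.
- apply/seteqP; split=> z.
    move=> [t]; rewrite /= in_itv/= => /andP[t1 t2] <-.
    have tI : t0 < t - c < t0 + 2 * pi by lra.
    exists (x (t - c)); last exact: cx.
    have := xE _ tI => e.
    by rewrite /= in_itv/=; apply/andP; split; rewrite -le_atanE; lra.
  move=> [y]; rewrite /= in_itv/= => /andP[y1 y2] <-.
  rewrite -le_atanE in y1; rewrite -le_atanE in y2.
  exists (t0 + pi - 2 * atan y + c); last by rewrite /c cisDpi.
  by rewrite /= in_itv/=; lra.
- by rewrite setUC !cx//; lra.
Qed.

Lemma normc_ge_Im (R : rcfType) (z : R[i]) : `|complex.Im z|%:C <= `|z|.
Proof.
by case: z => a b; simpc; rewrite -sqrtr_sqr ler_wsqrtr// lerDr sqr_ge0.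
Qed.

Lemma continuous_contraction_C (R : realType) (f : R[i] -> R) :
  (forall z w, f z - f w = f (z - w)) -> (forall z, `|f z|%:C <= `|z|) ->
  continuous (f : R[i]^o -> R).
Proof.
move=> fB fle z A /(@nbhs_ballP _ R^o)[e /= e0 eA].
have e0' : (0 : R[i]) < e%:C by rewrite ltcR.
apply/(@nbhs_ballP _ R[i]^o); exists e%:C => // w.
rewrite /ball/= => zw; apply: eA; rewrite /ball/= fB -ltcR.
exact: le_lt_trans zw.
Qed.

Lemma continuous_Re (R : realType) : continuous (@complex.Re R : R[i]^o -> R).
Proof.
apply: continuous_contraction_C; last exact: normc_ge_Re.
by move=> [a b] [c d].
Qed.

Lemma continuous_Im (R : realType) : continuous (@complex.Im R : R[i]^o -> R).
Proof.
apply: continuous_contraction_C; last exact: normc_ge_Im.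
by move=> [a b] [c d].
Qed.

(** * Measures on the plane *)

Lemma open_measurable_borelC (R : realType) (U : set (borelC R)) :
  @open R[i]^o U -> measurable U.
Proof. by move=> oU; apply: sub_sigma_algebra. Qed.

Lemma continuous_measurable_borelC (R : realType) (f : R[i]^o -> R) :
  continuous f -> measurable_fun setT (f : borelC R -> R).
Proof.
move=> /continuousP cf; apply: (measurability _ (RGenOpens.measurableE R)).
move=> _ [_ [a [b ->] <-]]; rewrite setTI; apply: open_measurable_borelC.
exact/cf/interval_open.
Qed.

Lemma measurable_Re (R : realType) :
  measurable_fun setT (@complex.Re R : borelC R -> R).
Proof. by apply: continuous_measurable_borelC; exact: continuous_Re. Qed.

Lemma measurable_Im (R : realType) :
  measurable_fun setT (@complex.Im R : borelC R -> R).
Proof. by apply: continuous_measurable_borelC; exact: continuous_Im. Qed.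

Lemma measurable_fun_invr d (T : measurableType d) (R : realType) (f : T -> R) :
  measurable_fun setT f -> measurable_fun setT (fun x => (f x)^-1).
Proof.
(* The inverse through a measurable power; where f vanishes, the factor f x reproduces the default
   value 0. *)
move=> mf; have -> : (fun x => (f x)^-1) = (fun x => f x * (f x ^+ 2) `^ (-1)).
  apply/funext => x; rewrite powR_inv1 ?sqr_ge0//.
  by have [->|f0] := eqVneq (f x) 0; [rewrite invr0 mul0r|field].
apply: measurable_funM => //.
by apply: (measurableT_comp (measurable_powR _)); exact: measurable_funX.
Qed.

Lemma cara_kernel_ReIm (R : realType) (z w : R[i]) :
  let n := ((complex.Re w - complex.Re z) ^+ 2 +
            (complex.Im w - complex.Im z) ^+ 2)^-1 in
  complex.Re (cara_kernel z w) =
    ((complex.Re w + complex.Re z) * (complex.Re w - complex.Re z) +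
     (complex.Im w + complex.Im z) * (complex.Im w - complex.Im z)) * n /\
  complex.Im (cara_kernel z w) =
    ((complex.Im w + complex.Im z) * (complex.Re w - complex.Re z) -
     (complex.Re w + complex.Re z) * (complex.Im w - complex.Im z)) * n.
Proof.
by rewrite /cara_kernel; case: w => a b; case: z => c d /=; split; ring.
Qed.

Lemma measurable_cara_kernel (R : realType) (z : R[i]) :
  measurable_fun setT ((fun w => complex.Re (cara_kernel z w)) : borelC R -> R) /\
  measurable_fun setT ((fun w => complex.Im (cara_kernel z w)) : borelC R -> R).
Proof.
have mre := @measurable_Re R; have mim := @measurable_Im R.
have [-> ->] : (fun w => complex.Re (cara_kernel z w)) =
    (fun w => ((complex.Re w + complex.Re z) * (complex.Re w - complex.Re z) +
     (complex.Im w + complex.Im z) * (complex.Im w - complex.Im z)) *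
    ((complex.Re w - complex.Re z) ^+ 2 + (complex.Im w - complex.Im z) ^+ 2)^-1)
  /\ (fun w => complex.Im (cara_kernel z w)) =
    (fun w => ((complex.Im w + complex.Im z) * (complex.Re w - complex.Re z) -
     (complex.Re w + complex.Re z) * (complex.Im w - complex.Im z)) *
    ((complex.Re w - complex.Re z) ^+ 2 + (complex.Im w - complex.Im z) ^+ 2)^-1).
  by split; apply/funext => w; have [] := cara_kernel_ReIm z w.
have m1 : measurable_fun setT (fun w : borelC R =>
   ((complex.Re w - complex.Re z) ^+ 2 + (complex.Im w - complex.Im z) ^+ 2)^-1).
  apply: measurable_fun_invr; apply: measurable_funD; apply: measurable_funX;
    by apply: measurable_funB.
split; apply: measurable_funM => //;
  [apply: measurable_funD|apply: measurable_funB]; apply: measurable_funM;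
  by [apply: measurable_funD|apply: measurable_funB].
Qed.

Lemma measurable_cayley_inv (R : realType) (t0 : R) :
  measurable_fun setT (cayley_inv t0 : borelC R -> R).
Proof.
apply: (@measurableT_comp _ _ _ _ _ _ (@GRing.opp R) _
  (fun w : borelC R => complex.Im (cara_kernel (cis t0) w))) => //.
by have [] := measurable_cara_kernel (cis t0).
Qed.

Lemma circleE (R : realType) (z : R[i]) :
  circle R z <-> complex.Re z ^+ 2 + complex.Im z ^+ 2 = 1.
Proof.
case: z => a b; split; first exact: sqr_norm_circle.
by move=> /= ab; rewrite /circle/=; simpc; rewrite ab sqrtr1.
Qed.

Lemma measurable_circle (R : realType) : measurable (circle R : set (borelC R)).
Proof.
have m1 : measurable_fun setT (fun z : borelC R =>
    complex.Re z ^+ 2 + complex.Im z ^+ 2).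
  by apply: measurable_funD; apply: measurable_funX;
    [exact: measurable_Re|exact: measurable_Im].
have -> : circle R = setT `&` (fun z : borelC R =>
    complex.Re z ^+ 2 + complex.Im z ^+ 2) @^-1` [set 1].
  by apply/seteqP; split => z; rewrite setTI /= => /circleE.
exact: m1.
Qed.

Lemma measurable_borelC1 (R : realType) (z : R[i]) :
  measurable ([set z] : set (borelC R)).
Proof.
have -> : [set z] = (setT `&` (@complex.Re R : borelC R -> R) @^-1` [set complex.Re z])
    `&` (setT `&` (@complex.Im R : borelC R -> R) @^-1` [set complex.Im z]).
  apply/seteqP; split => [w ->//|[a b]]; rewrite !setTI /=.
  by case: z => c d /= [-> ->].
by apply: measurableI; [exact: measurable_Re|exact: measurable_Im].
Qed.

Lemma normc_le_ReIm (R : rcfType) (z : R[i]) :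
  `|z| <= (`|complex.Re z| + `|complex.Im z|)%:C.
Proof.
case: z => a b; rewrite lecE /= eqxx /=.
rewrite -(@ler_pXn2r _ 2) ?nnegrE ?sqrtr_ge0 ?addr_ge0//.
rewrite sqr_sqrtr ?addr_ge0 ?sqr_ge0// sqrrD !real_normK ?num_real//.
by rewrite -addrA lerD2l lerDr mulrn_wge0// mulr_ge0.
Qed.

(* The plane has a countable base of squares with rational centres. *)
Lemma negligible_locally_null (R : realType)
    (m : {measure set (borelC R) -> \bar R}) (A : set R[i]) :
  (forall z, A z -> exists U : set R[i]^o, [/\ open U, U z & m U = 0%E]) ->
  m.-negligible (A : set (borelC R)).
Proof.
move=> Anull.
pose B (c : rat * rat * nat) : set R[i]^o :=
  [set w | `|complex.Re w - ratr c.1.1| < c.2.+1%:R^-1 /\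
           `|complex.Im w - ratr c.1.2| < c.2.+1%:R^-1].
have oB c : open (B c).
  have cont (f : R[i]^o -> R) (q : rat) : continuous f ->
      open [set w | `|f w - ratr q| < c.2.+1%:R^-1].
    move=> cf; set r := c.2.+1%:R^-1.
    have -> : [set w | `|f w - ratr q| < r] = f @^-1` `]ratr q - r, ratr q + r[.
      apply/seteqP; split=> w /=; rewrite in_itv/= ltr_norml => /andP[*];
        by apply/andP; split; lra.
    by apply: open_comp => [w _|]; [exact: cf|exact: interval_open].
  by apply: openI; apply: cont; [exact: continuous_Re|exact: continuous_Im].
pose F k := if unpickle k is Some c then
  if `[< m (B c) = 0%E >] then B c else set0 else set0.
apply: (@negligibleS _ _ _ m (\bigcup_k F k)); last first.
  apply: negligible_bigcup => k; rewrite /F; case: unpickle => [c|].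
    case: asboolP => [mB0|_]; last exact: negligible_set0.
    by exists (B c); split=> //; apply: open_measurable_borelC.
  exact: negligible_set0.
move=> z Az; have [U [oU Uz mU0]] := Anull z Az.
have : nbhs (z : R[i]^o) U by exact: open_nbhs_nbhs.
move=> /nbhs_ballP[e /= e0 zeU].
have [r re r0] : exists2 r : R, r%:C = e & 0 < r.
  case: e e0 {zeU} => a b; rewrite ltcE /= => /andP[/eqP -> a0].
  by exists a.
(* Each coordinate of z - w will be below 2/(k+1), so its norm is below 4/(k+1) < r. *)
have [k kr] : exists k : nat, k.+1%:R^-1 < r / 4.
  have r4 : 0 < r / 4 by rewrite divr_gt0.
  exists (Num.truncn (r / 4)^-1); rewrite invf_plt ?posrE ?ltr0n//.
  exact: truncnS_gt.
have k0 : 0 < k.+1%:R^-1 :> R by rewrite invr_gt0 ltr0n.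
have ratn (x : R) : exists q : rat, `|x - ratr q| < k.+1%:R^-1.
  have [|q] := @rat_in_itvoo R (x - k.+1%:R^-1) (x + k.+1%:R^-1).
    by rewrite ltrBlDr -addrA ltrDl addr_gt0.
  rewrite in_itv/= => /andP[q1 q2]; exists q; rewrite ltr_norml.
  move: q1 q2; set r' := _^-1 => *; by apply/andP; split; lra.
have [q1 hq1] := ratn (complex.Re z); have [q2 hq2] := ratn (complex.Im z).
exists (pickle (q1, q2, k)); [exact: I|rewrite /F pickleK].
have BU : B (q1, q2, k) `<=` U.
  move=> w [w1 w2]; apply: zeU; rewrite /ball/= -re.
  apply: le_lt_trans (normc_le_ReIm _) _; rewrite ltcR.
  have [-> ->] : complex.Re (z - w) = complex.Re z - complex.Re w /\
      complex.Im (z - w) = complex.Im z - complex.Im w.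
    by clear; case: z w => ? ? [].
  have := ler_distD (ratr q1) (complex.Re z) (complex.Re w).
  have := ler_distD (ratr q2) (complex.Im z) (complex.Im w).
  rewrite [`|ratr q1 - _|]distrC [`|ratr q2 - _|]distrC.
  move: w1 w2 hq1 hq2 kr; rewrite /=; set d := _^-1; clear.
  by lra.
have mB0 : m (B (q1, q2, k)) = 0%E.
  apply: (@subset_measure0 _ (borelC R) R m (B (q1, q2, k)) U) => //;
    exact: open_measurable_borelC.
by rewrite asboolT.
Qed.

Lemma continuous_cayley_inv (R : realType) (t0 x : R) :
  {for cayley t0 x, continuous (cayley_inv t0 : R[i]^o -> R)}.
Proof.
have -> : cayley_inv t0 = (fun z => 2 * (complex.Re (cis t0) * complex.Im z -
  complex.Im (cis t0) * complex.Re z) *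
  ((complex.Re z - complex.Re (cis t0)) ^+ 2 +
   (complex.Im z - complex.Im (cis t0)) ^+ 2)^-1).
  by apply/funext => z; rewrite cayley_invE.
have cre := @continuous_Re R (cayley t0 x).
have cim := @continuous_Im R (cayley t0 x).
have cst_ (c : R) : (fun=> c) @ nbhs (cayley t0 x : R[i]^o) --> c by exact: cvg_cst.
apply: (@cvgM _ _ (nbhs (cayley t0 x : R[i]^o))).
  apply: (@cvgM _ _ (nbhs (cayley t0 x : R[i]^o))); first exact: cst_.
  apply: (@cvgB _ _ _ (nbhs (cayley t0 x : R[i]^o))).
    by apply: (@cvgM _ _ (nbhs (cayley t0 x : R[i]^o))).
  by apply: (@cvgM _ _ (nbhs (cayley t0 x : R[i]^o))).
have cN : (fun z : R[i]^o => (complex.Re z - complex.Re (cis t0)) ^+ 2 +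
   (complex.Im z - complex.Im (cis t0)) ^+ 2) @ nbhs (cayley t0 x : R[i]^o) -->
   (complex.Re (cayley t0 x) - complex.Re (cis t0)) ^+ 2 +
   (complex.Im (cayley t0 x) - complex.Im (cis t0)) ^+ 2.
  have csub (f : R[i]^o -> R) (c : R) : f @ nbhs (cayley t0 x : R[i]^o) --> f (cayley t0 x) ->
      (fun z : R[i]^o => (f z - c) ^+ 2) @ nbhs (cayley t0 x : R[i]^o) -->
      (f (cayley t0 x) - c) ^+ 2.
    move=> cf; have h : (fun z : R[i]^o => f z - c) @ nbhs (cayley t0 x : R[i]^o) -->
      f (cayley t0 x) - c.
      by apply: (@cvgB _ _ _ (nbhs (cayley t0 x : R[i]^o))) => //; exact: cst_.
    by apply: (@cvgM _ _ (nbhs (cayley t0 x : R[i]^o))).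
  by apply: (@cvgD _ _ _ (nbhs (cayley t0 x : R[i]^o))); exact: csub.
apply: (@cvgV _ _ (nbhs (cayley t0 x : R[i]^o))) => //.
have := cayley_neq t0 x; rewrite eq_complex negb_and => h.
rewrite paddr_eq0 ?sqr_ge0// !sqrf_eq0 !subr_eq0 negb_and; exact: h.
Qed.

Lemma arc_interior (R : realType) (t0 p q x : R) : p < x < q ->
  circle_interior [set cayley t0 y | y in `[p, q]] (cayley t0 x).
Proof.
move=> /andP[px xq]; split; first exact: norm_cayley.
have h : \forall w \near (cayley t0 x : R[i]^o), cayley_inv t0 w \in `]p, q[.
  have := @continuous_cayley_inv R t0 x [set y | y \in `]p, q[].
  rewrite cayleyK; apply; apply: near_in_itvoo.
  by rewrite in_itv/= px.
(* At the cut point [cayley_inv] has the default value 0, which may lie in ]p, q[; that point has to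
   be kept away separately. *)
have h' : \forall w \near (cayley t0 x : R[i]^o), w != cis t0.
  apply/(@nbhs_ballP _ R[i]^o); exists `|cayley t0 x - cis t0|.
    by rewrite /= normr_gt0 subr_eq0 cayley_neq.
  by move=> w; rewrite /ball/=; apply: contraTneq => ->; rewrite ltxx.
have : \forall w \near (cayley t0 x : R[i]^o), (cayley_inv t0 w \in `]p, q[) /\ w != cis t0.
  by apply: filterI.
apply: filterS => w [wpq we] wc; exists (cayley_inv t0 w); last exact: cayley_invK.
by move: wpq; rewrite /= !in_itv/= => /andP[*]; rewrite !ltW.
Qed.

(** * Bounded integrands, null sets and densities *)

Lemma ae_bounded_integrable d (T : measurableType d) (R : realType)
    (m : {finite_measure set T -> \bar R}) (A : set T) (f : T -> R) (C : R) :
  measurable A -> measurable_fun A f ->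
  {ae m, forall w, A w -> `|f w| <= C} -> m.-integrable A (EFin \o f).
Proof.
move=> mA mf fC; apply/integrableP; split; first exact/measurable_EFinP.
have [C0|C0] := leP 0 C; last first.
  apply: le_lt_trans (ltry 0); rewrite le_eqVlt; apply/orP; left; apply/eqP.
  apply/ae_eq_integral_abs => //; first exact/measurable_EFinP.
  apply: filterS fC => w h Aw; have := le_lt_trans (h Aw) C0.
  by rewrite ltNge normr_ge0.
apply: le_lt_trans.
  apply: (@integral_le_bound _ _ _ m A _ C%:E) => //; first exact/measurable_EFinP.
by rewrite lte_mul_pinfty// -ge0_fin_numE// fin_num_measure.
Qed.

Lemma Rintegral_setD1_null d (T : measurableType d) (R : realType)
    (m : {measure set T -> \bar R}) (A N : set T) (f : T -> R) :
  measurable A -> measurable N -> N `<=` A -> m N = 0%E ->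
  measurable_fun N f -> m.-integrable (A `\` N) (EFin \o f) ->
  m.-integrable A (EFin \o f) /\
  \int[m]_(w in A) f w = \int[m]_(w in A `\` N) f w.
Proof.
move=> mA mN NA N0 mfN iF.
have mf : measurable_fun A (EFin \o f).
  rewrite -(setDUK NA); apply/measurable_funU => //; first exact: measurableD.
  by split; [exact/measurable_EFinP|exact: measurable_int iF].
have iA : m.-integrable A (EFin \o f).
  apply/integrableP; split=> //.
  rewrite (ge0_negligible_integral mN)//; last exact: measurableT_comp.
  by case/integrableP : iF.
by split=> //; congr fine; rewrite (negligible_integral mN).
Qed.

(** k agrees almost everywhere on D with the Radon-Nikodym derivative, since both have the same
    integrals over measurable subsets of D; the change of variables for that derivative then
    applies. *)
Lemma density_Rintegral d (T : measurableType d) (R : realType)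
    (nu m : {finite_measure set T -> \bar R}) (D : set T) (k g : T -> R) :
  measurable D -> nu (~` D) = 0%E -> m.-integrable D (EFin \o k) ->
  (forall A, measurable A -> A `<=` D -> nu A = \int[m]_(w in A) (k w)%:E)%E ->
  nu.-integrable D (EFin \o g) ->
  \int[nu]_(w in D) g w = \int[m]_(w in D) (g w * k w).
Proof.
move=> mD nuD ik nuE ig.
have dom : nu `<< m.
  apply/null_content_dominatesP => A mA mA0.
  have mAD : measurable (A `&` D) by exact: measurableI.
  have mAC : measurable (A `&` ~` D) by apply: measurableI => //; exact: measurableC.
  have h1 : nu (A `&` D) = 0%E.
    rewrite nuE; [|by []|exact: subIsetr].
    apply: null_set_integral => //.
      by apply: measurable_funS (measurable_int _ ik) => //; exact: subIsetr.
    by apply: (subset_measure0 mAD mA) mA0; exact: subIsetl.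
  have h2 : nu (A `&` ~` D) = 0%E.
    by apply: (subset_measure0 mAC _ _ nuD); [exact: measurableC|exact: subIsetr].
  have -> : A = (A `&` D) `|` (A `&` ~` D) by rewrite -setIUr setUCr setIT.
  apply: measure_negligible; first exact: measurableU.
  by apply: negligibleU; apply/negligibleP.
pose rn := Radon_Nikodym (charge_of_finite_measure nu) m.
have irn : m.-integrable setT rn by apply: Radon_Nikodym_integrable.
have rnE : ae_eq m D (EFin \o k) rn.
  apply: integral_ae_eq => //.
    by apply: measurable_funTS; exact: measurable_int irn.
  move=> A AD mA; rewrite -nuE// /rn -Radon_Nikodym_integral//.
congr fine.
rewrite -(Radon_Nikodym_change_of_variables dom mD ig); apply: ae_eq_integral => //.
- apply: emeasurable_funM; first exact: measurable_int ig.
  by apply: measurable_funTS; exact: measurable_int irn.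
- apply: (@eq_measurable_fun _ _ _ _ _ ((EFin \o g) \* (EFin \o k))%E).
    by move=> w _.
  by apply: emeasurable_funM; [exact: measurable_int ig|exact: measurable_int ik].
- apply: filterS rnE => w h Dw; rewrite -/rn -(h Dw).
  by rewrite EFinM.
Qed.

(** * Almost-everywhere statements and supports for measures of constant sign *)

Lemma cs_aeS (R : realType) (mu : csmeasure R) (P Q : borelC R -> Prop) :
  (forall w, P w -> Q w) -> {ae csabs mu, forall w, P w} ->
  {ae csabs mu, forall w, Q w}.
Proof. by move=> PQ; apply: negligibleS; apply: subsetC => w; exact: PQ. Qed.

Lemma cs_aeI (R : realType) (mu : csmeasure R) (P Q : borelC R -> Prop) :
  {ae csabs mu, forall w, P w} -> {ae csabs mu, forall w, Q w} ->
  {ae csabs mu, forall w, P w /\ Q w}.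
Proof.
move=> aeP aeQ; apply: negligibleS (negligibleU aeP aeQ) => w /= /not_andP.
by case=> h; [left|right].
Qed.

Lemma cssupp_ae (R : realType) (mu : csmeasure R) (A : set R[i]) :
  cssupp mu `<=` A -> {ae csabs mu, forall w, A w}.
Proof.
move=> suppA; apply: negligible_locally_null => z nAz.
have /existsNP[U /not_implyP[oU /not_implyP[Uz mU]]] : ~ cssupp mu z.
  by move=> /suppA.
exists U; split=> //; apply/eqP; rewrite eq_le measure_ge0 andbT leNgt.
exact/negP.
Qed.

Lemma open_notin_seq (R : realType) (s : seq R[i]) :
  open ([set w | w \notin s] : set R[i]^o).
Proof.
elim: s => [|z s IH].
  have -> : ([set w | w \notin [::]] : set R[i]^o) = setT by apply/seteqP; split.
  exact: openT.
have -> : ([set w | w \notin z :: s] : set R[i]^o) =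
    [set w | w != z] `&` [set w | w \notin s].
  by apply/seteqP; split=> w /=; rewrite inE negb_or => /andP.
apply: openI => //; rewrite openE => w /= wz; rewrite /interior.
apply/(@nbhs_ballP _ R[i]^o); exists `|w - z|; first by rewrite /= normr_gt0 subr_eq0.
by move=> u; rewrite /ball/=; apply: contraTneq => ->; rewrite ltxx.
Qed.

Lemma cssupp_infinite (R : realType) (mu : csmeasure R) (s : seq R[i]) :
  infinite_set (cssupp mu) -> ~ {ae csabs mu, forall w, w \in s}.
Proof.
move=> inf mus; apply: inf.
apply: (@sub_finite_set _ _ [set` s]); last exact: finite_seq.
move=> z suppz /=; apply/negPn/negP => zs.
have oU : open ([set w | w \notin s] : set R[i]^o) by exact: open_notin_seq.
have := suppz _ oU zs; rewrite (@measure_negligible _ _ _ (csabs mu)) ?ltxx//.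
  exact: open_measurable_borelC.
by apply: negligibleS mus => w /= /negP.
Qed.

(** * The Caratheodory integral in the Cayley coordinate *)

Definition punctured_circle (R : realType) (t0 : R) : set (borelC R) :=
  circle R `\` [set cis t0].

Lemma measurable_punctured_circle (R : realType) (t0 : R) :
  measurable (punctured_circle t0).
Proof. by apply: measurableD; [exact: measurable_circle|exact: measurable_borelC1]. Qed.

Lemma cara_kernel_punctured (R : realType) (t0 x : R) (w : R[i]) :
  punctured_circle t0 w ->
  cara_kernel (cayley t0 x) w = 0 -i* markov_kernel x (cayley_inv t0 w).
Proof.
by move=> [wc /= we]; rewrite -{1}(cayley_invK wc (introN eqP we)) cara_kernel_cayley.
Qed.

Lemma cara_converges_markov (R : realType) (t0 x : R) (mu : csmeasure R) :
  csabs mu [set cis t0] = 0%E -> cara_converges mu (cayley t0 x) ->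
  (csabs mu).-integrable (punctured_circle t0)
    (EFin \o (markov_kernel x \o cayley_inv t0)) /\
  cara mu (cayley t0 x) = (-1) ^+ csneg mu *
    (0 -i* markov_fun (csabs mu) (punctured_circle t0) (cayley_inv t0) x).
Proof.
move=> mue [_ [ire iim]].
have sub : punctured_circle t0 `<=` circle R by exact: subDsetl.
have mD := measurable_punctured_circle t0.
have mc := @measurable_circle R; have me := measurable_borelC1 (cis t0).
have im : (csabs mu).-integrable (punctured_circle t0)
    (EFin \o (markov_kernel x \o cayley_inv t0)).
  have := integrableN (integrableS mc mD sub iim).
  apply: eq_integrable => // w /set_mem Dw /=.
  by rewrite (cara_kernel_punctured _ Dw)/= opprK.
split=> //; rewrite /cara /csintegral; congr (_ * (_ +i* _)).
  rewrite /Rintegral (negligible_integral me)//.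
  rewrite integral0_eq// => w Dw.
  by rewrite (cara_kernel_punctured _ Dw).
rewrite /Rintegral (negligible_integral me)//.
rewrite -[RHS]mulN1r /markov_fun -RintegralZl//; congr fine.
apply: eq_integral => w /set_mem Dw.
by rewrite (cara_kernel_punctured _ Dw)/= mulN1r.
Qed.

Lemma markov_kernel_bound (R : realType) (p q x y : R) :
  ~ (p <= x <= q) -> p <= y <= q ->
  `|markov_kernel x y| <=
  (1 + `|x| * (`|p| + `|q|)) / Num.min `|x - p| `|x - q|.
Proof.
move=> xpq /andP[py yq].
have xp : x != p by apply/eqP => xp; apply: xpq; rewrite xp lexx (le_trans py).
have xq : x != q by apply/eqP => xq; apply: xpq; rewrite xq lexx (le_trans py).
have d0 : 0 < Num.min `|x - p| `|x - q|.
  by rewrite lt_min !normr_gt0 !subr_eq0 xp xq.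
have dle : Num.min `|x - p| `|x - q| <= `|x - y|.
  rewrite ge_min; have [xlp|plx] := ltP x p.
    have xly : x < y by apply: (lt_le_trans xlp).
    have -> : `|x - p| = p - x by rewrite ltr0_norm ?subr_lt0// opprB.
    have -> : `|x - y| = y - x by rewrite ltr0_norm ?subr_lt0// opprB.
    by rewrite lerD2r py.
  have qx : q < x by rewrite ltNge; apply/negP => h; apply: xpq; rewrite plx.
  have yx : y < x by apply: (le_lt_trans yq).
  have -> : `|x - q| = x - q by rewrite gtr0_norm ?subr_gt0.
  have -> : `|x - y| = x - y by rewrite gtr0_norm ?subr_gt0.
  by rewrite lerD2l lerN2 yq orbT.
rewrite /markov_kernel normrM normfV ler_pM//.
- rewrite (le_trans (ler_normD _ _))// normr1 lerD2l normrM ler_wpM2l//.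
  rewrite ler_norml; apply/andP; split.
    have := ler_norm (- p); have := normr_ge0 q; rewrite normrN; lra.
  by have := ler_norm q; have := normr_ge0 p; lra.
- by rewrite lef_pV2// posrE (lt_le_trans d0).
Qed.

Lemma cara_converges_off (R : realType) (t0 x p q : R) (mu : csmeasure R) :
  {ae csabs mu, forall w, [set cayley t0 y | y in `[p, q]] w} ->
  ~ (p <= x <= q) -> cara_converges mu (cayley t0 x).
Proof.
move=> aepq xpq; split.
  apply: measure_negligible; first exact: measurable_borelC1.
  apply: negligibleS aepq => w /= -> [y]; rewrite /= in_itv/= => ypq.
  by move/(can_inj (@cayleyK R t0)) => yx; apply: xpq; rewrite -yx.
have [mre mim] := measurable_cara_kernel (cayley t0 x).
split.
  apply: (@ae_bounded_integrable _ (borelC R) R _ _ _ 0).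
  - exact: measurable_circle.
  - exact: measurable_funTS.
  - apply: cs_aeS aepq => w [y _ <-] _.
    by rewrite cara_kernel_cayley/= normr0.
apply: (@ae_bounded_integrable _ (borelC R) R _ _ _
  ((1 + `|x| * (`|p| + `|q|)) / Num.min `|x - p| `|x - q|)).
- exact: measurable_circle.
- exact: measurable_funTS.
- apply: cs_aeS aepq => w [y /=]; rewrite in_itv/= => ypq <- _.
  by rewrite cara_kernel_cayley/= normrN markov_kernel_bound.
Qed.

(** A point interior to the first interval and in the closed second one could be moved slightly into
    the interior of both, because p2 < q2. So the arcs meet at most at endpoints. *)
Lemma arc_disjoint (R : realType) (t0 p1 q1 p2 q2 x : R) :
  p2 < q2 ->
  circle_interior [set cayley t0 y | y in `[p1, q1]] `&`
    circle_interior [set cayley t0 y | y in `[p2, q2]] = set0 ->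
  p1 < x < q1 -> ~ (p2 <= x <= q2).
Proof.
move=> pq2 dis /andP[px xq] /andP[p2x xq2].
have key y : p1 < y < q1 -> p2 < y < q2 -> False.
  move=> h1 h2; have : set0 (cayley t0 y); last by [].
  by rewrite -dis; split; exact: arc_interior.
have [xlt|] := ltP x q2.
  pose c := Num.min q1 q2; have xc : x < c by rewrite lt_min xq xlt.
  have [cq1 cq2] : c <= q1 /\ c <= q2 by rewrite !ge_min !lexx orbT.
  apply: (key ((x + c) / 2)); apply/andP; split; lra.
move=> q2x; pose c := Num.max p1 p2.
have cx : c < x by rewrite gt_max px (lt_le_trans pq2).
have [cp1 cp2] : p1 <= c /\ p2 <= c by rewrite !le_max !lexx orbT.
apply: (key ((x + c) / 2)); apply/andP; split; lra.
Qed.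

(** * Real and imaginary parts of polynomials, and their moments *)

Definition re_poly (R : rcfType) (P : {poly R[i]}) : {poly R} :=
  \poly_(i < size P) complex.Re P`_i.

Definition im_poly (R : rcfType) (P : {poly R[i]}) : {poly R} :=
  \poly_(i < size P) complex.Im P`_i.

Lemma coef_re_poly (R : rcfType) (P : {poly R[i]}) i :
  (re_poly P)`_i = complex.Re P`_i.
Proof. by rewrite coef_poly; case: ltnP => // h; rewrite nth_default. Qed.

Lemma coef_im_poly (R : rcfType) (P : {poly R[i]}) i :
  (im_poly P)`_i = complex.Im P`_i.
Proof. by rewrite coef_poly; case: ltnP => // h; rewrite nth_default. Qed.

Lemma re_polyXnM (R : rcfType) (P : {poly R[i]}) k :
  re_poly ('X^k * P) = 'X^k * re_poly P.
Proof.
by apply/polyP => i; rewrite coef_re_poly !coefXnM coef_re_poly; case: ifP.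
Qed.

Lemma im_polyXnM (R : rcfType) (P : {poly R[i]}) k :
  im_poly ('X^k * P) = 'X^k * im_poly P.
Proof.
by apply/polyP => i; rewrite coef_im_poly !coefXnM coef_im_poly; case: ifP.
Qed.

Lemma sum_complex (R : rcfType) n (F G : 'I_n -> R) :
  \sum_i (F i +i* G i) = (\sum_i F i) +i* (\sum_i G i).
Proof. by elim/big_rec3: _ => // i x y z _ ->; simpc. Qed.

Lemma horner_re_im (R : rcfType) (P : {poly R[i]}) (x t : R) :
  P.[x%:C] * t%:C = ((re_poly P).[x] * t) +i* ((im_poly P).[x] * t).
Proof.
have sre : (size (re_poly P) <= size P)%N by exact: size_poly.
have sim : (size (im_poly P) <= size P)%N by exact: size_poly.
rewrite (horner_coef_wide _ sre) (horner_coef_wide _ sim) horner_coef.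
have -> : \sum_(i < size P) P`_i * x%:C ^+ i =
    (\sum_(i < size P) (re_poly P)`_i * x ^+ i) +i*
    (\sum_(i < size P) (im_poly P)`_i * x ^+ i).
  rewrite -sum_complex; apply: eq_bigr => i _.
  by rewrite coef_re_poly coef_im_poly -rmorphXn/=; case: (P`_i) => a b; simpc.
by simpc.
Qed.

Lemma moment_form_complex (R : rcfType) (mom : nat -> R) (e : nat)
    (P : {poly R[i]}) :
  moment_form (fun i => (mom i)%:C) e P =
  moment_form mom e (re_poly P) +i* moment_form mom e (im_poly P).
Proof.
rewrite /moment_form -sum_complex; apply: eq_bigr => i _.
by rewrite coef_re_poly coef_im_poly; case: (P`_i) => a b; simpc.
Qed.

Lemma circle_moment (R : realType) (t0 : R)
    (m : {finite_measure set (borelC R) -> \bar R}) (k G : borelC R -> R)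
    (e : nat) (p : {poly R}) :
  m [set cis t0] = 0%E -> m.-integrable (circle R) (EFin \o k) ->
  (size p <= e.+1)%N ->
  (forall w, punctured_circle t0 w ->
    G w = p.[cayley_inv t0 w] * inv_japanese (cayley_inv t0 w) ^+ e) ->
  m.-integrable (circle R) (EFin \o (fun w => G w * k w)) /\
  \int[m]_(w in circle R) (G w * k w) =
  moment_form (weighted_moment m (punctured_circle t0) (cayley_inv t0) k e) e p.
Proof.
move=> me ik sp GE.
have mc := @measurable_circle R; have mD := measurable_punctured_circle t0.
have sub : punctured_circle t0 `<=` circle R by exact: subDsetl.
have ikD := integrableS mc mD sub ik.
have mX : measurable_fun (punctured_circle t0) (cayley_inv t0 : borelC R -> R).
  by apply: measurable_funTS; exact: measurable_cayley_inv.
have iGk := integrable_weighted_poly mD mX ikD sp.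
have iG : m.-integrable (punctured_circle t0) (EFin \o (fun w => G w * k w)).
  by apply: eq_integrable iGk => // w /set_mem Dw /=; rewrite GE.
have cise : [set cis t0] `<=` circle R by move=> w ->; exact: norm_cis.
have [iGc ->] := Rintegral_setD1_null mc (measurable_borelC1 _) cise me
  (@measurable_fun_set1 _ _ _ _ _ _) iG.
split=> //; rewrite /moment_form -weighted_moment_poly//.
by apply: eq_Rintegral => w /set_mem Dw; rewrite GE.
Qed.

Lemma csintegral_density (R : realType) (t0 : R) (nu mu : csmeasure R)
    (k : borelC R -> R) (F : borelC R -> R[i]) (e : nat) (P : {poly R[i]}) :
  csabs mu [set cis t0] = 0%E -> {ae csabs nu, forall w, circle R w} ->
  (csabs mu).-integrable (circle R) (EFin \o k) ->
  (forall A : set (borelC R), measurable A -> A `<=` circle R ->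
    csabs nu A = \int[csabs mu]_(w in A) (k w)%:E)%E ->
  (size P <= e.+1)%N ->
  (forall w, punctured_circle t0 w -> F w =
    P.[(cayley_inv t0 w)%:C] * (inv_japanese (cayley_inv t0 w) ^+ e)%:C) ->
  csintegral nu (circle R) F = (-1) ^+ csneg nu * moment_form (fun i =>
    (weighted_moment (csabs mu) (punctured_circle t0) (cayley_inv t0) k e i)%:C) e P.
Proof.
move=> mue nuc ik nuE sP FE.
have mc := @measurable_circle R.
have cise : [set cis t0] `<=` circle R by move=> w ->; exact: norm_cis.
have nue : csabs nu [set cis t0] = 0%E.
  rewrite nuE//; last exact: measurable_borelC1.
  apply: null_set_integral => //; first exact: measurable_borelC1.
  by apply: (measurable_funS mc cise); exact: measurable_int ik.
have nuC : csabs nu (~` circle R) = 0%E.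
  by apply: measure_negligible; [exact: measurableC|exact: nuc].
have i1 : (csabs nu).-integrable (circle R) (EFin \o (fun=> 1)).
  by apply: (@ae_bounded_integrable _ _ _ _ _ _ 1) => //; apply: aeW => w _;
    rewrite normr1.
have FD w : punctured_circle t0 w -> F w =
    ((re_poly P).[cayley_inv t0 w] * inv_japanese (cayley_inv t0 w) ^+ e) +i*
    ((im_poly P).[cayley_inv t0 w] * inv_japanese (cayley_inv t0 w) ^+ e).
  by move=> Dw; rewrite FE// horner_re_im.
have real (G : borelC R -> R) (p : {poly R}) : (size p <= e.+1)%N ->
    (forall w, punctured_circle t0 w ->
    G w = p.[cayley_inv t0 w] * inv_japanese (cayley_inv t0 w) ^+ e) ->
    \int[csabs nu]_(w in circle R) G w = moment_form (weighted_moment (csabs mu)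
      (punctured_circle t0) (cayley_inv t0) k e) e p.
  move=> sp GE; have [iG _] := circle_moment nue i1 sp GE.
  have [_ <-] := circle_moment mue ik sp GE.
  apply: density_Rintegral => //.
  by move: iG; congr (_.-integrable _ _); apply/funext => w /=; rewrite mulr1.
rewrite /csintegral moment_form_complex; congr (_ * (_ +i* _)).
  apply: real; first by rewrite (leq_trans (size_poly _ _)).
  by move=> w Dw; rewrite FD.
apply: real; first by rewrite (leq_trans (size_poly _ _)).
by move=> w Dw; rewrite FD.
Qed.

Lemma moment_formZ (A : comNzRingType) (mom : nat -> A) (c : A) (e : nat)
    (p : {poly A}) :
  moment_form (fun i => c * mom i) e p = c * moment_form mom e p.
Proof.
by rewrite /moment_form mulr_sumr; apply: eq_bigr => i _; rewrite mulrCA.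
Qed.

(** Links two exponents: N + n - 2, given by the degrees on the line, and N + n, needed to write the
    leading term of phi and the lower ones over one weight. *)
Lemma weighted_moment_lift d (T : measurableType d) (R : realType)
    (m : {measure set T -> \bar R}) (D : set T) (X h : T -> R) (e : nat)
    (p : {poly R}) :
  measurable D -> measurable_fun D X -> m.-integrable D (EFin \o h) ->
  (size p <= e.+1)%N ->
  moment_form (weighted_moment m D X h e) e p =
  moment_form (weighted_moment m D X h e.+2) e.+2 (p * (1 + 'X^2)).
Proof.
move=> mD mX ih sp.
have sp2 : (size (p * (1 + 'X^2))%R <= e.+3)%N.
  rewrite mulrC (leq_trans (@size_polyM_le _ _ _ 2 e.+1 _ sp))//.
  by rewrite (leq_trans (size_polyD _ _))// size_poly1 size_polyXn.
rewrite /moment_form -!weighted_moment_poly//; apply: eq_Rintegral => w _.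
have -> : inv_japanese (X w) ^+ e.+2 = inv_japanese (X w) ^+ e / (1 + X w ^+ 2).
  by rewrite -addn2 exprD sqr_inv_japanese.
rewrite hornerM hornerD hornerXn hornerC; congr (_ * _).
by field; rewrite gt_eqF// ltr_pwDl ?sqr_ge0.
Qed.

Lemma csintegral_eq0_moment (R : realType) (t0 : R) (nu mu : csmeasure R)
    (h : borelC R -> R) (c : R) (F : borelC R -> R[i]) (e : nat) (P : {poly R[i]}) :
  csabs mu [set cis t0] = 0%E -> {ae csabs nu, forall w, circle R w} ->
  (csabs mu).-integrable (circle R) (EFin \o h) -> c != 0 ->
  (forall A : set (borelC R), measurable A -> A `<=` circle R ->
    csval nu A = c * \int[csabs mu]_(w in A) h w) ->
  (size P <= e.+1)%N ->
  (forall w, punctured_circle t0 w -> F w =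
    P.[(cayley_inv t0 w)%:C] * (inv_japanese (cayley_inv t0 w) ^+ e)%:C) ->
  csintegral nu (circle R) F = 0 <-> moment_form (fun i =>
    (weighted_moment (csabs mu) (punctured_circle t0) (cayley_inv t0) h e i)%:C) e P
    = 0.
Proof.
move=> mue nuc ih c0 nuE sP FE.
have mc := @measurable_circle R; have mD := measurable_punctured_circle t0.
(* The signs of the measures are collected in one nonzero constant, so that c' h is the density of
   |nu| with respect to |mu|; vanishing conditions do not see it. *)
pose c' : R := (-1) ^+ csneg nu * c.
have c'0 : c' != 0 by rewrite mulf_neq0// signr_eq0.
have ich : (csabs mu).-integrable (circle R) (EFin \o (fun w => c' * h w)).
  by have := integrableZl mc c' ih; exact: eq_integrable.
have nuE' (A : set (borelC R)) : measurable A -> A `<=` circle R ->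
    (csabs nu A = \int[csabs mu]_(w in A) (c' * h w)%:E)%E.
  move=> mA Ac; have ihA := integrableS mc mA Ac ih.
  have ichA := integrableS mc mA Ac ich.
  rewrite -[LHS]fineK ?fin_num_measure// -[RHS]fineK; last exact: integrable_fin_num.
  congr _%:E; rewrite -/(Rintegral _ _ _) RintegralZl// /c' -mulrA -nuE// /csval.
  by rewrite mulrA -signr_addb addbb mul1r.
rewrite (csintegral_density mue nuc ich nuE' sP FE).
have -> : moment_form (fun i => (weighted_moment (csabs mu) (punctured_circle t0)
    (cayley_inv t0) (fun w => c' * h w) e i)%:C) e P =
    c'%:C * moment_form (fun i => (weighted_moment (csabs mu) (punctured_circle t0)
    (cayley_inv t0) h e i)%:C) e P.
  rewrite -moment_formZ /moment_form; apply: eq_bigr => i _; congr (_ * _).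
  rewrite -rmorphM; congr _%:C; rewrite /weighted_moment.
  rewrite -RintegralZl//; first by apply: eq_Rintegral => w _; ring.
  have sub : punctured_circle t0 `<=` circle R by exact: subDsetl.
  have mX : measurable_fun (punctured_circle t0) (cayley_inv t0 : borelC R -> R).
    by apply: measurable_funTS; exact: measurable_cayley_inv.
  have sX : (size ('X^i : {poly R}) <= e.+1)%N by rewrite size_polyXn.
  have := integrable_weighted_poly mD mX (integrableS mc mD sub ih) sX.
  by apply: eq_integrable => // w _ /=; rewrite hornerXn.
split=> [/eqP|->]; last by rewrite !mulr0.
rewrite !mulf_eq0 signr_eq0/= => /orP[/eqP [/eqP]|/eqP//].
by rewrite (negPf c'0).
Qed.

(** Encloses the measure theory: afterwards the problem is linear algebra over two families of real
    moments, indexed also by e because the weight depends on it. The third clause is the triviality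
    of the transposed kernel. *)
Lemma nikishin_reduction (R : realType) (t0 : R) (G1 G2 : circle_arc R)
    (s1 s2 mu1 mu2 : csmeasure R) :
  nikishin G1 G2 s1 s2 mu1 mu2 ->
  ~ (arc_set G1 `|` arc_set G2) (cis t0) ->
  cara_nonzero_on G1 G2 s2 ->
  exists mom1 mom2 : nat -> nat -> R,
  [/\ forall (F : borelC R -> R[i]) e (P : {poly R[i]}), (size P <= e.+1)%N ->
        (forall w, punctured_circle t0 w -> F w =
          P.[(cayley_inv t0 w)%:C] * (inv_japanese (cayley_inv t0 w) ^+ e)%:C) ->
        csintegral mu1 (circle R) F = 0 <->
        moment_form (fun i => (mom1 e i)%:C) e P = 0,
      forall (F : borelC R -> R[i]) e (P : {poly R[i]}), (size P <= e.+1)%N ->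
        (forall w, punctured_circle t0 w -> F w =
          P.[(cayley_inv t0 w)%:C] * (inv_japanese (cayley_inv t0 w) ^+ e)%:C) ->
        csintegral mu2 (circle R) F = 0 <->
        moment_form (fun i => (mom2 e i)%:C) e P = 0
    & forall M n1 n2 e1 e2 (a b : {poly R}),
        (n1 + n2 = M.*2)%N -> (0 < M)%N -> (e1 = M.*2 + n1)%N ->
        (e2 = M.*2 + n2)%N -> (size a <= n1)%N -> (size b <= n2)%N ->
        (forall k, (k < M.*2)%N ->
          moment_form (mom1 e1) e1 ('X^k * (a * (1 + 'X^2))) +
          moment_form (mom2 e2) e2 ('X^k * (b * (1 + 'X^2))) = 0) ->
        a = 0 /\ b = 0].
Proof.
move=> [dis gap [inf1 sup1] [inf2 sup2] [infm1 supm1] [infm2 supm2] mu1E conv ih mu2E].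
move=> ncut hF.
have ncut1 : ~ arc_set G1 (cis t0) by move=> h; apply: ncut; left.
have ncut2 : ~ arc_set G2 (cis t0) by move=> h; apply: ncut; right.
have [p1 [q1 [pq1 arc1 ends1]]] := arc_cayley ncut1.
have [p2 [q2 [pq2 arc2 ends2]]] := arc_cayley ncut2.
rewrite arc1 in sup1 dis ncut1; rewrite arc2 in sup2 dis ncut2.
have ae1 := cssupp_ae sup1; have ae2 := cssupp_ae sup2.
have mc := @measurable_circle R; have mD := measurable_punctured_circle t0.
have me := measurable_borelC1 (cis t0).
have sub : punctured_circle t0 `<=` circle R by exact: subDsetl.
have m1e : csabs s1 [set cis t0] = 0%E.
  by apply: measure_negligible => //; apply: negligibleS ae1 => w /= ->.
have m2e : csabs s2 [set cis t0] = 0%E.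
  by apply: measure_negligible => //; apply: negligibleS ae2 => w /= ->.
(* Convergence can fail only at endpoints of the first arc, so E remains an interval, possibly not
   closed. *)
pose E : set R := [set x | p1 <= x <= q1 /\ cara_converges s2 (cayley t0 x)].
have disj := arc_disjoint pq2 dis.
have itvE : is_interval E.
  move=> x y [/andP[px xq] cx] [/andP[py yq] cy] z /andP[xz zy].
  split; first by rewrite (le_trans px)// (le_trans zy).
  have [<-//|nxz] := eqVneq x z; have [->//|nzy] := eqVneq z y.
  apply: (cara_converges_off ae2); apply: disj.
  apply/andP; split.
    by apply: (le_lt_trans px); rewrite lt_neqAle nxz.
  by apply: (lt_le_trans _ yq); rewrite lt_neqAle nzy.
have DX x : punctured_circle t0 (cayley t0 x).
  by split; [exact: norm_cayley|move=> /= /eqP; exact/negP/cayley_neq].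
have XE : {ae csabs s1, forall w, punctured_circle t0 w -> E (cayley_inv t0 w)}.
  apply: cs_aeS (cs_aeI ae1 conv) => w [[x /= + <-] cx] _.
  by rewrite in_itv/= => xpq; rewrite cayleyK.
have ninf (mu : csmeasure R) (p q : R) : infinite_set (cssupp mu) ->
    {ae csabs mu, forall w, [set cayley t0 x | x in `[p, q]] w} ->
    forall s : seq R,
    ~ {ae csabs mu, forall w, punctured_circle t0 w -> cayley_inv t0 w \in s}.
  move=> inf aepq s aes; apply: (@cssupp_infinite R mu (map (cayley t0) s) inf).
  apply: cs_aeS (cs_aeI aepq aes) => w [[x _ <-] h].
  by apply: map_f; rewrite -(cayleyK t0 x); exact/h/DX.
have conv_val x (Ex : E x) := cara_converges_markov m2e (proj2 Ex).
pose f := markov_fun (csabs s2) (punctured_circle t0) (cayley_inv t0).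
have sgn2 : (-1) ^+ csneg s2 * (-1) ^+ csneg s2 = 1 :> R.
  by rewrite -signr_addb addbb.
have sgnC (b : bool) : (-1) ^+ b = ((-1) ^+ b)%:C :> R[i].
  by rewrite rmorphXn rmorphN rmorph1.
(* Inner points of the first arc avoid the second one, and an endpoint that belongs to E carries no
   atom of s2 by [cara_converges]. *)
have nX : {ae csabs s2, forall w, punctured_circle t0 w -> ~ E (cayley_inv t0 w)}.
  have nul x : {ae csabs s2, forall w, ~ (w = cayley t0 x /\ E x)}.
    have [[_ [m0 _]]|nEx] := pselect (E x); last by apply: aeW => w [].
    exists [set cayley t0 x]; split=> //; first exact: measurable_borelC1.
    by move=> w /= /contrapT[].
  apply: cs_aeS (cs_aeI ae2 (cs_aeI (nul p1) (nul q1))) => w.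
  move=> [[y /= + <-] [np1 nq1]] _; rewrite in_itv/= cayleyK => ypq [/andP[py yq] cy].
  have Ey : E y by split=> //; rewrite py.
  have [e|np] := eqVneq p1 y; first by apply: np1; rewrite e.
  have [e|nq] := eqVneq y q1; first by apply: nq1; rewrite -e.
  by apply: (disj y) ypq; rewrite !lt_neqAle np nq py yq.
have f0 x : E x -> f x != 0.
  move=> Ex; apply/eqP => fx0; have [xpq cx] := Ex.
  apply: (hF (cayley t0 x)).
  - by rewrite arc1; exists x.
  - by move=> _.
  - by have [_ ->] := conv_val x Ex; rewrite -/f fx0 oppr0 mulr0.
(* The sign of s2 is divided out, so that h is the Markov function of the positive measure |s2| on
   E. *)
pose h w := (-1) ^+ csneg s2 * complex.Re ((0 +i* 1) * cara s2 w).
have hE x : E x -> h (cayley t0 x) = f x.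
  move=> Ex; rewrite /h; have [_ ->] := conv_val x Ex; rewrite -/f sgnC.
  have mulI (s y : R) : (0 +i* 1) * (s%:C * (0 -i* y)) = (s * y)%:C.
    by simpc.
  by rewrite mulI/= mulrA sgn2 mul1r.
have ihC : (csabs s1).-integrable (circle R) (EFin \o h).
  by have := integrableZl mc ((-1) ^+ csneg s2) ih.1; apply: eq_integrable.
have i1C : (csabs s1).-integrable (circle R) (EFin \o cst 1).
  by apply: (@ae_bounded_integrable _ _ _ _ _ _ 1) => //; apply: aeW => w _;
    rewrite normr1.
exists (weighted_moment (csabs s1) (punctured_circle t0) (cayley_inv t0) (cst 1)).
exists (weighted_moment (csabs s1) (punctured_circle t0) (cayley_inv t0) h).
split.
- move=> F e P sP FE.
  apply: (@csintegral_eq0_moment R t0 mu1 s1 (cst 1) ((-1) ^+ csneg s1)) => //.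
  + exact: cssupp_ae supm1.
  + by rewrite signr_eq0.
  + move=> A mA Ac; rewrite mu1E// /csval; congr (_ * _).
    by rewrite Rintegral_cst// mul1r.
- move=> F e P sP FE.
  apply: (@csintegral_eq0_moment R t0 mu2 s1 h
    ((-1) ^+ csneg s1 * (-1) ^+ csneg s2)) => //.
  + exact: cssupp_ae supm2.
  + by rewrite mulf_neq0// signr_eq0.
  + move=> A mA Ac; have /(congr1 (@complex.Re R)) := mu2E A mA Ac.
    rewrite /csintegral sgnC; simpc => /= ->.
    have ihA := integrableS mc mA Ac ih.1.
    by rewrite /h RintegralZl// mulrA -(mulrA _ _ ((-1) ^+ csneg s2)) sgn2 mulr1.
- move=> M n1 n2 e1 e2 a b nM M0 e1E e2E sa sb mom0.
  have mX : measurable_fun (punctured_circle t0) (cayley_inv t0 : borelC R -> R).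
    by apply: measurable_funTS; exact: measurable_cayley_inv.
  have i1D := integrableS mc mD sub i1C; have ihD := integrableS mc mD sub ihC.
  (* M > 0 makes e1 and e2 at least 2, so the truncated predecessors are genuine. *)
  have e1E' : (e1.-2.+2 = M.*2 + n1)%N by move: e1E M0; clear; lia.
  have e2E' : (e2.-2.+2 = M.*2 + n2)%N by move: e2E M0; clear; lia.
  apply: (@nikishin_line _ (borelC R) R (csabs s1) (csabs s2) (punctured_circle t0)
    (cayley_inv t0) h E M n1 n2 e1.-2 e2.-2 a b) => //; last first.
  + move=> k kM; have skp n (p : {poly R}) e : (e.+2 = M.*2 + n)%N ->
        (size p <= n)%N -> (size ('X^k * p)%R <= e.+1)%N.
      move=> eE sp; apply: leq_trans (@size_polyM_le _ _ _ k n _ sp) _.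
        by rewrite size_polyXn.
      by move: kM eE; clear; lia.
    rewrite (weighted_moment_lift mD mX i1D (skp _ _ _ e1E' sa)).
    rewrite (weighted_moment_lift mD mX ihD (skp _ _ _ e2E' sb)).
    by rewrite e1E' e2E' -e1E -e2E -!mulrA mom0.
  + apply: cs_aeS (cs_aeI ae1 XE) => w [[x _ <-] Ex] Dw.
    by have := Ex Dw; rewrite cayleyK => /hE.
  + exact: ninf ae2.
  + by move=> x Ex; have [] := conv_val x Ex.
  + exact: ninf ae1.
Qed.

(** * Half-integer powers and the linear system *)

(** The angle in [cayley] lies in [t0, t0 + 2 pi), where angles are unique; it is therefore the
    argument that the branch selects. *)
Lemma sqrtC_cut_cayley (R : realType) (t0 x : R) :
  sqrtC_cut t0 (cayley t0 x) =
  cis (t0 / 2) * ((x +i* 1) * (inv_japanese x)%:C).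
Proof.
rewrite /sqrtC_cut norm_cayley sqrtr1 mul1r -cis_half_cayley.
congr (cis (_ / 2)); rewrite /argC.
set P := [set t | _].
have [h1 h2] : P (xget t0 P).
  apply: xgetPex; exists (t0 + pi - 2 * atan x); split.
    exact: cayley_angle_bounds.
  by rewrite norm_cayley mul1r.
move: h2; rewrite norm_cayley mul1r /cayley => /esym.
by apply: cis_inj h1 _; exact: cayley_angle_bounds.
Qed.

Definition xpi (R : realType) : {poly R[i]} := 'X + 'i%:P.
Definition xmi (R : realType) : {poly R[i]} := 'X - 'i%:P.

(* z^(e/2 - b) is half_power_poly t0 e b, up to the factor (1 + x^2)^(-e/2). *)
Definition half_power_poly (R : realType) (t0 : R) (e b : nat) : {poly R[i]} :=
  cis (t0 / 2) ^ (e%:Z - b.*2%:Z) *: (xpi R ^+ (e - b) * xmi R ^+ b).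

Lemma hpow_cayley (R : realType) (t0 x : R) (e b : nat) : (b <= e)%N ->
  hpow t0 (e%:Z - b.*2%:Z) (cayley t0 x) =
  (half_power_poly t0 e b).[x%:C] * (inv_japanese x ^+ e)%:C.
Proof.
move=> be; rewrite /hpow sqrtC_cut_cayley /half_power_poly hornerZ hornerM !horner_exp.
have -> : (xpi R).[x%:C] = x +i* 1.
  by rewrite /xpi hornerD hornerX hornerC; simpc.
have -> : (xmi R).[x%:C] = x -i* 1.
  by rewrite /xmi hornerD hornerX hornerN hornerC; simpc.
set u := x +i* 1; set v := x -i* 1; set t := (inv_japanese x)%:C.
(* (x + i)(1 + x^2)^(-1/2) has modulus one, so its inverse is its conjugate; negative powers become
   powers of x - i. *)
have uvt : (u * t) * (v * t) = 1.
  have -> : (u * t) * (v * t) = (u * v) * (t * t) by ring.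
  rewrite /t -rmorphM -expr2 sqr_inv_japanese /u /v.
  have w0 : 1 + x ^+ 2 != 0 by rewrite gt_eqF// ltr_pwDl ?sqr_ge0.
  by simpc; congr (_ +i* _); field.
have ut0 : u * t != 0.
  by apply/eqP => ut; move: uvt; rewrite ut mul0r => /esym/eqP; rewrite oner_eq0.
have vtE : (u * t)^-1 = v * t by apply: (mulfI ut0); rewrite divff// uvt.
rewrite expfzMl -!mulrA; congr (_ * _).
have -> : e%:Z - b.*2%:Z = (e - b)%N%:Z - b%:Z by lia.
rewrite expfzDr// -exprnN -exprnP -exprVn vtE !exprMn.
rewrite rmorphXn -[in RHS](subnK be) exprD addnK.
rewrite -/t; ring.
Qed.

Lemma moment_form_linear (A : comNzRingType) (mom : nat -> A) (e : nat) (c : A)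
    (p q : {poly A}) :
  moment_form mom e (c *: p + q) = c * moment_form mom e p + moment_form mom e q.
Proof.
rewrite /moment_form mulr_sumr -big_split/=; apply: eq_bigr => i _.
by rewrite coefD coefZ mulrDl mulrA.
Qed.

Lemma moment_form0 (A : comNzRingType) (mom : nat -> A) (e : nat) :
  moment_form mom e 0 = 0.
Proof. by rewrite /moment_form big1// => i _; rewrite coef0 mul0r. Qed.

Lemma moment_form_sum (A : comNzRingType) (mom : nat -> A) (e n : nat)
    (c : 'I_n -> A) (p : 'I_n -> {poly A}) :
  moment_form mom e (\sum_i c i *: p i) = \sum_i c i * moment_form mom e (p i).
Proof.
elim/big_rec2: _ => [|i y q _ <-]; first exact: moment_form0.
exact: moment_form_linear.
Qed.

(** These products span the polynomials of degree below m: for q of degree below m - 1, the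
    difference of (X + c) q and (X - c) q is 2c q, and with q itself available, (X + c) q yields X
    q. The dual form suits the transposed system, which asserts that a functional vanishes. *)
Lemma homogeneous_span (K : fieldType) (c : K) (L : {poly K} -> K) (m : nat) :
  2 * c != 0 -> (forall a p q, L (a *: p + q) = a * L p + L q) ->
  (forall j, (j < m)%N ->
    L (('X + c%:P) ^+ (m.-1 - j) * ('X - c%:P) ^+ j) = 0) ->
  forall p : {poly K}, (size p <= m)%N -> L p = 0.
Proof.
move=> c0; elim: m L => [|m IH] L Llin L0 p sp.
  have L00 : L 0 = 0.
    have := Llin 1 0 0; rewrite scaler0 addr0 mul1r => /eqP.
    by rewrite -subr_eq0 opprD addNKr oppr_eq0 => /eqP.
  by move: sp; rewrite leqn0 size_poly_eq0 => /eqP ->.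
have L00 : L 0 = 0.
  have := Llin 1 0 0; rewrite scaler0 addr0 mul1r => /eqP.
  by rewrite -subr_eq0 opprD addNKr oppr_eq0 => /eqP.
have LZ a q : L (a *: q) = a * L q by rewrite -[a *: q]addr0 Llin L00 addr0.
have LD q r : L (q + r) = L q + L r by rewrite -[q]scale1r Llin scale1r mul1r.
have [m0|m0] := posnP m.
  have := L0 0%N; rewrite m0 /= !expr0 mul1r => /(_ isT) L1.
  rewrite m0 in sp; rewrite (size1_polyC sp) -[_%:P]mulr1 mul_polyC LZ.
  by rewrite L1 mulr0.
have Lu (q : {poly K}) : (size q <= m)%N -> L (('X + c%:P) * q) = 0.
  apply: (IH (fun q : {poly K} => L (('X + c%:P) * q))) => [a r s|j jm].
    by rewrite mulrDr -scalerAr Llin.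
  by rewrite mulrA -exprS -[RHS](L0 j (ltnW jm)); congr (L (_ ^+ _ * _)); lia.
have Lv (q : {poly K}) : (size q <= m)%N -> L (('X - c%:P) * q) = 0.
  apply: (IH (fun q : {poly K} => L (('X - c%:P) * q))) => [a r s|j jm].
    by rewrite mulrDr -scalerAr Llin.
  rewrite mulrCA -exprS -[RHS](L0 j.+1 jm); congr (L (_ ^+ _ * _)); lia.
have Lq (q : {poly K}) : (size q <= m)%N -> L q = 0.
  move=> sq; apply: (mulfI c0); rewrite mulr0 -LZ.
  have -> : (2 * c) *: q = ('X + c%:P) * q + (- 1) *: (('X - c%:P) * q).
    by rewrite scaleN1r -mul_polyC polyCM; ring.
  by rewrite LD LZ Lu// Lv// mulr0 addr0.
have LX (q : {poly K}) : (size q <= m)%N -> L ('X * q) = 0.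
  move=> sq; have := Lu q sq.
  by rewrite mulrDl LD mul_polyC LZ (Lq q sq) mulr0 addr0.
rewrite -(poly_take_drop 1 p) LD Lq ?add0r; last first.
  by rewrite (leq_trans (size_take_poly _ _)).
rewrite expr1 mulrC LX// size_drop_poly; lia.
Qed.

(** At - c every product but the last vanishes, so its coefficient is zero; the rest is divisible by
    X + c, and the quotient has one term fewer. *)
Lemma homogeneous_free (K : fieldType) (c : K) (n : nat) (a : nat -> K) :
  2 * c != 0 ->
  \sum_(l < n) a l *: (('X + c%:P) ^+ (n.-1 - l) * ('X - c%:P) ^+ l) = 0 ->
  forall l, (l < n)%N -> a l = 0.
Proof.
move=> c0; elim: n => // n IH.
have step : \sum_(l < n.+1) a l *: (('X + c%:P) ^+ (n.+1.-1 - l) * ('X - c%:P) ^+ l) =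
    (\sum_(l < n) a l *: (('X + c%:P) ^+ (n.-1 - l) * ('X - c%:P) ^+ l)) *
      ('X + c%:P) + a n *: ('X - c%:P) ^+ n.
  rewrite big_ord_recr/= subnn expr0 mul1r; congr (_ + _).
  rewrite mulr_suml; apply: eq_bigr => l _; rewrite -scalerAl mulrAC -exprSr.
  by congr (_ *: (_ ^+ _ * _)); have := ltn_ord l; lia.
rewrite step => sum0.
have an : a n = 0.
  have /(congr1 (fun p : {poly K} => p.[- c])) := sum0.
  rewrite hornerD hornerM hornerD hornerX hornerC addNr mulr0 add0r hornerZ.
  rewrite horner_exp hornerXsubC horner0 -opprD -mulr2n -mulr_natl => /eqP.
  by rewrite mulf_eq0 expf_eq0 oppr_eq0 (negPf c0) andbF orbF => /eqP.
move: sum0; rewrite an scale0r addr0 => /eqP; rewrite mulf_eq0 => /orP[/eqP s0|].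
  by move=> l; rewrite ltnS leq_eqVlt => /predU1P[->//|]; exact: IH.
have -> : 'X + c%:P = 'X - (- c)%:P by rewrite polyCN opprK.
by rewrite polyXsubC_eq0.
Qed.

Lemma size_half_power_poly (R : realType) (t0 : R) (e b : nat) :
  (b <= e)%N -> (size (half_power_poly t0 e b) <= e.+1)%N.
Proof.
move=> be; rewrite (leq_trans (size_scale_leq _ _))//.
have sz (p : {poly R[i]}) k : (size p <= 2)%N -> (size (p ^+ k)%R <= k.+1)%N.
  move=> sp; rewrite (leq_trans (size_poly_exp_leq _ _))// ltnS -[leqRHS]mul1n.
  by rewrite leq_mul2r; case: (size p) sp => [|n]/= h; rewrite ?orbT//; apply/orP; right.
have s1 : (size (xpi R) <= 2)%N.
  by rewrite /xpi -[_%:P]opprK -polyCN size_XsubC.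
have s2 : (size (xmi R) <= 2)%N by rewrite size_XsubC.
have := @size_polyM_le _ _ _ (e - b) b.+1 (sz _ (e - b)%N s1) (sz _ b s2).
by rewrite addnS subnK.
Qed.

Lemma moment_formD (A : comNzRingType) (mom : nat -> A) (e : nat) (p q : {poly A}) :
  moment_form mom e (p + q) = moment_form mom e p + moment_form mom e q.
Proof. by rewrite -[p in LHS]scale1r moment_form_linear mul1r. Qed.

Lemma moment_form_scale (A : comNzRingType) (mom : nat -> A) (e : nat) (c : A)
    (p : {poly A}) : moment_form mom e (c *: p) = c * moment_form mom e p.
Proof. by rewrite -[c *: p]addr0 moment_form_linear moment_form0 addr0. Qed.

Lemma moment_form_sumM (A : comNzRingType) (mom : nat -> A) (e n : nat)
    (c : 'I_n -> A) (q : 'I_n -> {poly A}) (p w : {poly A}) :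
  moment_form mom e (p * ((\sum_i c i *: q i) * w)) =
  \sum_i c i * moment_form mom e (p * (q i * w)).
Proof.
rewrite mulr_suml mulr_sumr -moment_form_sum; congr moment_form.
by apply: eq_bigr => i _; rewrite -!mul_polyC; ring.
Qed.

(* All the products phi z^(-k) are written over the common weight (1 + x^2)^(-(N+n)/2),
   those from the lower terms of phi carrying an extra factor 1 + x^2. *)
Lemma phi_orthogonalE (R : realType) (t0 : R) (N n : nat) (mu : csmeasure R)
    (mom : nat -> R[i]) (kappa : 'I_N -> R[i]) :
  (forall (F : borelC R -> R[i]) (P : {poly R[i]}), (size P <= (N + n).+1)%N ->
    (forall w, punctured_circle t0 w -> F w = P.[(cayley_inv t0 w)%:C] *
      (inv_japanese (cayley_inv t0 w) ^+ (N + n))%:C) ->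
    csintegral mu (circle R) F = 0 <-> moment_form mom (N + n) P = 0) ->
  phi_orthogonal t0 n mu (phi_form t0 kappa) <->
  forall l, (l < n)%N ->
    moment_form mom (N + n) (half_power_poly t0 (N + n) l) +
    \sum_(j < N) kappa j *
      moment_form mom (N + n) (half_power_poly t0 (N + n) (j.+1 + l)) = 0.
Proof.
move=> H; pose P l := half_power_poly t0 (N + n) l +
  \sum_(j < N) kappa j *: half_power_poly t0 (N + n) (j.+1 + l).
have PE l : moment_form mom (N + n) (P l) =
    moment_form mom (N + n) (half_power_poly t0 (N + n) l) +
    \sum_(j < N) kappa j *
      moment_form mom (N + n) (half_power_poly t0 (N + n) (j.+1 + l)).
  by rewrite moment_formD moment_form_sum.
suff key l : (l < n)%N -> csintegral mu (circle R) (fun z => phi_form t0 kappa z *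
    hpow t0 (- (l.*2%:Z - n%:Z)) z) = 0 <-> moment_form mom (N + n) (P l) = 0.
  by split=> h l ln; [rewrite -PE; exact/key/h|apply/key => //; rewrite PE; exact: h].
move=> ln; apply: H => [|w [wc /= /eqP we]].
  rewrite (leq_trans (size_polyD _ _))// geq_max size_half_power_poly/=; last by lia.
  apply: (leq_trans (size_sum _ _ _)); apply/bigmax_leqP => j _.
  rewrite (leq_trans (size_scale_leq _ _))// size_half_power_poly//.
  by have := ltn_ord j; lia.
rewrite -{1 2}(cayley_invK wc we); set x := cayley_inv t0 w.
have z0 : sqrtC_cut t0 (cayley t0 x) != 0.
  rewrite sqrtC_cut_cayley !mulf_neq0 ?cis_neq0//.
    by rewrite eq_complex /= oner_eq0 andbF.
  by rewrite eq_complex /= gt_eqF// inv_japanese_gt0.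
rewrite /phi_form mulrDl mulr_suml /P hornerD horner_sum mulrDl mulr_suml.
congr (_ + _).
  rewrite -hpow_cayley; last by lia.
  by rewrite /hpow -expfzDr//; congr (_ ^ _); lia.
apply: eq_bigr => j _; rewrite hornerZ -[RHS]mulrA -hpow_cayley; last first.
  by have := ltn_ord j; lia.
by rewrite /hpow -mulrA -expfzDr//; congr (_ * _ ^ _); lia.
Qed.

Lemma unitmx_inj (K : fieldType) (n : nat) (A : 'M[K]_n) :
  (forall v : 'cV_n, A *m v = 0 -> v = 0) -> A \in unitmx.
Proof.
move=> inj; rewrite -unitmx_tr -row_free_unit; apply: inj_row_free => v vA.
apply: trmx_inj; rewrite trmx0; apply: inj.
by rewrite -[A]trmxK -trmx_mul vA trmx0.
Qed.

Lemma re_poly_mulw (R : rcfType) (P : {poly R[i]}) :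
  re_poly (P * (1 + 'X^2)) = re_poly P * (1 + 'X^2).
Proof.
apply/polyP => i; rewrite coef_re_poly !mulrDr !mulr1 !coefD !coefMXn !coef_re_poly.
by case: ifP => _; case: (P`_i) => a b; [rewrite /= addr0|case: (P`_(i - 2))].
Qed.

Lemma im_poly_mulw (R : rcfType) (P : {poly R[i]}) :
  im_poly (P * (1 + 'X^2)) = im_poly P * (1 + 'X^2).
Proof.
apply/polyP => i; rewrite coef_im_poly !mulrDr !mulr1 !coefD !coefMXn !coef_im_poly.
by case: ifP => _; case: (P`_i) => a b; [rewrite /= addr0|case: (P`_(i - 2))].
Qed.

Lemma re_im_poly_eq0 (R : rcfType) (P : {poly R[i]}) :
  re_poly P = 0 -> im_poly P = 0 -> P = 0.
Proof.
move=> re0 im0; apply/polyP => i; apply/eqP; rewrite coef0 eq_complex.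
by rewrite -coef_re_poly -coef_im_poly re0 im0 !coef0 eqxx.
Qed.

(** The row index j and the column index l separate into homogeneous factors of degrees N - 1 and n
    - 1. The shift j + 1 leaves the two remaining degrees as (x + i)(x - i) = 1 + x^2. *)
Lemma half_power_poly_split (R : realType) (t0 : R) (N n j l : nat) :
  (j < N)%N -> (l < n)%N ->
  half_power_poly t0 (N + n) (j.+1 + l) =
  cis (t0 / 2) ^ (N.-1%:Z - j.*2%:Z) *:
    (xpi R ^+ (N.-1 - j) * xmi R ^+ j *
     (half_power_poly t0 n.-1 l * (1 + 'X^2))).
Proof.
move=> jN ln; rewrite /half_power_poly.
have -> : (N + n)%N%:Z - (j.+1 + l).*2%:Z =
    (N.-1%:Z - j.*2%:Z) + (n.-1%:Z - l.*2%:Z) by lia.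
have -> : (N + n - (j.+1 + l) = (N.-1 - j) + (n.-1 - l) + 1)%N by lia.
rewrite expfzDr ?cis_neq0// !exprD expr1.
have -> : 1 + 'X^2 = xpi R * xmi R.
  rewrite /xpi /xmi mulrC -subr_sqr -polyC_exp (sqr_i R) polyCN opprK.
  by rewrite addrC.
rewrite -scalerA; congr (_ *: _); rewrite -scalerAl -scalerAr; congr (_ *: _).
by rewrite exprS; ring.
Qed.

Lemma phi_normal_even (R : realType) (t0 : R) (G1 G2 : circle_arc R)
    (s1 s2 mu1 mu2 : csmeasure R) (M n1 n2 : nat) :
  nikishin G1 G2 s1 s2 mu1 mu2 ->
  ~ (arc_set G1 `|` arc_set G2) (cis t0) ->
  cara_nonzero_on G1 G2 s2 ->
  (n1 + n2 = M.*2)%N -> phi_normal t0 n1 n2 mu1 mu2.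
Proof.
move=> hN hcut hF nM.
have [mom1 [mom2 [H1 H2 H3]]] := nikishin_reduction hN hcut hF.
set N := (n1 + n2)%N in nM.
pose mf1 := moment_form (fun i => (mom1 (N + n1)%N i)%:C) (N + n1).
pose mf2 := moment_form (fun i => (mom2 (N + n2)%N i)%:C) (N + n2).
have o1 kappa := @phi_orthogonalE R t0 N n1 mu1 _ kappa
  (fun F P sP => H1 F (N + n1)%N P sP).
have o2 kappa := @phi_orthogonalE R t0 N n2 mu2 _ kappa
  (fun F P sP => H2 F (N + n2)%N P sP).
(* Rows belong to the coefficients of phi and columns to the orthogonality conditions; r below
   collects the leading term of phi. *)
pose A : 'M[R[i]]_N := \matrix_(j, k) match fintype.split k with
  | inl l => mf1 (half_power_poly t0 (N + n1) (j.+1 + l))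
  | inr l => mf2 (half_power_poly t0 (N + n2) (j.+1 + l)) end.
pose r : 'rV[R[i]]_N := \row_k match fintype.split k with
  | inl l => mf1 (half_power_poly t0 (N + n1) l)
  | inr l => mf2 (half_power_poly t0 (N + n2) l) end.
have orthE (kappa : 'I_N -> R[i]) : phi_orthogonal t0 n1 mu1 (phi_form t0 kappa) /\
    phi_orthogonal t0 n2 mu2 (phi_form t0 kappa) <-> r + (\row_j kappa j) *m A = 0.
  split=> [[/o1 h1 /o2 h2]|h].
    apply/rowP => k; rewrite !mxE; under eq_bigr do rewrite !mxE.
    by case: fintype.split => l; [exact: h1|exact: h2].
  split; [apply/o1 => l ln|apply/o2 => l ln].
    have /rowP/(_ (lshift n2 (Ordinal ln))) := h.
    rewrite !mxE; under eq_bigr do rewrite !mxE.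
    by rewrite -[lshift _ _]/(unsplit (inl _)) unsplitK.
  have /rowP/(_ (rshift n1 (Ordinal ln))) := h.
  rewrite !mxE; under eq_bigr do rewrite !mxE.
  by rewrite -[rshift _ _]/(unsplit (inr _)) unsplitK.
have Aunit : A \in unitmx.
  (* For N = 0 the matrix is empty; the reduction to the line requires M > 0. *)
  have [M0|M0] := posnP M.
    apply: unitmx_inj => v _; apply/colP => k.
    by have := ltn_ord k; rewrite {2}nM M0.
  apply: unitmx_inj => v Av.
  pose Q1 := \sum_(l < n1) v (lshift n2 l) 0 *: half_power_poly t0 n1.-1 l.
  pose Q2 := \sum_(l < n2) v (rshift n1 l) 0 *: half_power_poly t0 n2.-1 l.
  (* A v = 0 says that L kills the products (x + i)^(N-1-j) (x - i)^j, hence all polynomials of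
     degree below N, in particular the monomials. *)
  pose L (p : {poly R[i]}) := mf1 (p * (Q1 * (1 + 'X^2))) + mf2 (p * (Q2 * (1 + 'X^2))).
  have two_i : 2 * 'i != 0 :> R[i].
    rewrite mulf_neq0 ?(eqr_nat _ 2 0)//.
    by rewrite eq_complex /= oner_eq0 andbF.
  have L0 (p : {poly R[i]}) : (size p <= N)%N -> L p = 0.
    apply: (homogeneous_span two_i) => [c q q'|j jN].
      rewrite /L !mulrDl -!scalerAl /mf1 /mf2 !moment_form_linear; ring.
    have /colP/(_ (Ordinal jN)) := Av; rewrite !mxE big_split_ord/=.
    have cn0 : cis (t0 / 2) ^ (N.-1%:Z - j.*2%:Z) != 0.
      by rewrite expfz_neq0 ?cis_neq0.
    move=> /eqP; rewrite -(mulrI_eq0 _ (mulfI (invr_neq0 cn0))) => /eqP h.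
    rewrite -[RHS]h mulrDr; congr (_ + _).
      rewrite /Q1 /mf1 moment_form_sumM mulr_sumr; apply: eq_bigr => l _.
      rewrite !mxE -[lshift _ _]/(unsplit (inl _)) unsplitK/=.
      rewrite half_power_poly_split// /mf1 moment_form_scale -!mulrA mulrCA mulKf//; exact: mulrC.
    rewrite /Q2 /mf2 moment_form_sumM mulr_sumr; apply: eq_bigr => l _.
    rewrite !mxE -[rshift _ _]/(unsplit (inr _)) unsplitK/=.
    rewrite half_power_poly_split// /mf2 moment_form_scale -!mulrA mulrCA mulKf//; exact: mulrC.
  have LX k : (k < M.*2)%N -> L ('X^k) = 0.
    by move=> kM; apply: L0; rewrite size_polyXn nM.
  have sQ n (Q : {poly R[i]}) (c : 'I_n -> R[i]) :
      Q = \sum_(l < n) c l *: half_power_poly t0 n.-1 l -> (size Q <= n)%N.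
    move=> ->; apply: (leq_trans (size_sum _ _ _)); apply/bigmax_leqP => l _.
    rewrite (leq_trans (size_scale_leq _ _))//.
    have ln := ltn_ord l; rewrite (leq_trans (size_half_power_poly _ _))//; lia.
  have sQ1 := sQ _ Q1 _ erefl; have sQ2 := sQ _ Q2 _ erefl.
  (* As the moments are real, the real and the imaginary part of L = 0 are separate relations for
     the real and imaginary parts of Q1 and Q2. *)
  have [re1 re2] : re_poly Q1 = 0 /\ re_poly Q2 = 0.
    apply: (H3 M n1 n2 (N + n1)%N (N + n2)%N) => //; rewrite ?nM//.
    - exact: leq_trans (size_poly _ _) sQ1.
    - exact: leq_trans (size_poly _ _) sQ2.
    - move=> k kM; have /(congr1 (@complex.Re R)) := LX k kM.
      rewrite /L /mf1 /mf2 !moment_form_complex /= !re_polyXnM !re_poly_mulw.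
      by rewrite nM.
  have [im1 im2] : im_poly Q1 = 0 /\ im_poly Q2 = 0.
    apply: (H3 M n1 n2 (N + n1)%N (N + n2)%N) => //; rewrite ?nM//.
    - exact: leq_trans (size_poly _ _) sQ1.
    - exact: leq_trans (size_poly _ _) sQ2.
    - move=> k kM; have /(congr1 (@complex.Im R)) := LX k kM.
      rewrite /L /mf1 /mf2 !moment_form_complex /= !im_polyXnM !im_poly_mulw.
      by rewrite nM.
  have coef0 n (c : 'I_n -> R[i]) :
      \sum_(l < n) c l *: half_power_poly t0 n.-1 l = 0 -> forall l, c l = 0.
    move=> sum0 l; pose a k := if insub k is Some l then
      c l * cis (t0 / 2) ^ (n.-1%:Z - k.*2%:Z) else 0.
    have aE (k : 'I_n) : a k = c k * cis (t0 / 2) ^ (n.-1%:Z - k.*2%:Z).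
      by rewrite /a valK.
    have := @homogeneous_free _ 'i n a two_i.
    have -> : \sum_(l < n) a l *: (('X + 'i%:P) ^+ (n.-1 - l) * ('X - 'i%:P) ^+ l) = 0.
      by rewrite -[RHS]sum0; apply: eq_bigr => k _; rewrite aE -scalerA.
    move=> /(_ erefl l (ltn_ord l)); rewrite aE => /eqP.
    by rewrite mulf_eq0 (negPf (expfz_neq0 _ (cis_neq0 _))) orbF => /eqP.
  apply/colP => k; rewrite mxE; case: (splitP k) => l kl.
    have -> : k = lshift n2 l by exact: val_inj.
    by apply: (coef0 _ (fun l => v (lshift n2 l) 0)); exact: re_im_poly_eq0.
  have -> : k = rshift n1 l by exact: val_inj.
  by apply: (coef0 _ (fun l => v (rshift n1 l) 0)); exact: re_im_poly_eq0.
pose kappa0 := - r *m invmx A.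
exists (phi_form t0 (fun j => kappa0 0 j)); split.
  have [|h1 h2] := (orthE (fun j => kappa0 0 j)).2.
    have -> : \row_j kappa0 0 j = kappa0 by apply/rowP => j; rewrite mxE.
    by rewrite /kappa0 mulmxKV// subrr.
  by split=> //; exists (fun j => kappa0 0 j).
move=> phi [[kappa ->] h1 h2]; congr phi_form; apply/funext => j.
have /eqP := (orthE kappa).1 (conj h1 h2).
rewrite addrC addr_eq0 => /eqP /(congr1 (mulmx^~ (invmx A))).
by rewrite mulmxK// => /rowP/(_ j); rewrite mxE.
Qed.

Theorem theorem15 (R : realType) (t0 : R) (G1 G2 : circle_arc R)
    (s1 s2 mu1 mu2 : csmeasure R)
    (hN : nikishin G1 G2 s1 s2 mu1 mu2)
    (hcut : ~ (arc_set G1 `|` arc_set G2) (cis t0))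
    (hF : cara_nonzero_on G1 G2 s2) :
  (forall n1 n2 : nat, odd n1 -> odd n2 -> phi_normal t0 n1 n2 mu1 mu2) /\
  (forall n1 n2 : nat, ~~ odd n1 -> ~~ odd n2 -> phi_normal t0 n1 n2 mu1 mu2).
Proof.
have key n1 n2 : odd n1 = odd n2 -> phi_normal t0 n1 n2 mu1 mu2.
  move=> n12; apply: (@phi_normal_even _ _ _ _ _ _ _ _ (n1 + n2)./2 _ _ hN hcut hF).
  by rewrite -[LHS]odd_double_half oddD n12 addbb.
by split=> n1 n2 h1 h2; apply: key; [rewrite h1 h2|rewrite (negbTE h1) (negbTE h2)].
Qed.
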